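(* Assume: (A1) $\sup_{i,j}\|X_{ij}\|=O(\sqrt{p_n})$; (A2) the unknown parameter $\beta_n$ belongs to a compact subset $\mathcal{B}\subseteq\mathbb{R}^{p_n}$, the true value $\beta_{n0}$ lies in the interior of $\mathcal{B}$, and there are constants $b_1,b_2$ (not depending on $n$) with $0<b_1\le\pi_{ij}(\beta_{n0})\le b_2<1$ for all $i,j$; (A3) there are positive constants $b_3,b_4$ with $b_3\le\lambda_{\min}\big(n^{-1}\sum_{i=1}^nX_i^TX_i\big)\le\lambda_{\max}\big(n^{-1}\sum_{i=1}^nX_i^TX_i\big)\le b_4$; (A4) the common true correlation matrix $R_0$ has eigenvalues bounded away from $0$ and $+\infty$, and the estimated working correlation matrix $\widehat R$ satisfies $\|\widehat R^{-1}-\overline R^{-1}\|=O_p(\sqrt{p_n/n})$, where $\overline R$ is a constant positive definite matrix with eigenvalues bounded away from $0$ and $+\infty$ ($\overline R$ is not required to equal $R_0$). Suppose $n^{-1}p_n^3=o(1)$, and let $\widehat\beta_n$ be the GEE estimator, i.e. a root of $S_n(\beta_n)=0$ with $\|\widehat\beta_n-\beta_{n0}\|=O_p(\sqrt{p_n/n})$. Then $$C_n\widehat\Sigma_nC_n^T-C_n\Sigma_nC_n^T=o_p(n^{-1}),$$ where $C_n$ is any $l\times p_n$ matrix such that $l$ is fixed and $C_nC_n^T=G$ with $G$ an $l\times l$ positive definite matrix.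
   Context: Setting: the number of clusters $n\to\infty$, the cluster size $m<\infty$ is a fixed integer, and the number of covariates $p_n\to\infty$ as $n\to\infty$. For each $n$, each cluster $i=1,\dots,n$ and each $j=1,\dots,m$, one observes a binary response $Y_{ij}\in\{0,1\}$ and a covariate vector $X_{ij}\in\mathbb{R}^{p_n}$ (covariates are treated as fixed: all moments and probabilities are conditional on them; dependence on $n$ is suppressed). $Y_i=(Y_{i1},\dots,Y_{im})^T$, and $X_i=(X_{i1},\dots,X_{im})^T$ is the $m\times p_n$ matrix with rows $X_{ij}^T$. $Y_1,\dots,Y_n$ are independent; components of one $Y_i$ may be dependent. For $\beta\in\mathbb{R}^{p_n}$ let $\pi_{ij}(\beta)=\exp(X_{ij}^T\beta)/[1+\exp(X_{ij}^T\beta)]$ and $\pi_i(\beta)=(\pi_{i1}(\beta),\dots,\pi_{im}(\beta))^T$. The true parameter $\beta_{n0}$ satisfies $E(Y_{ij})=\pi_{ij}(\beta_{n0})$, hence $\mathrm{Var}(Y_{ij})=\pi_{ij}(\beta_{n0})(1-\pi_{ij}(\beta_{n0}))$. All $Y_i$ have the same $m\times m$ true correlation matrix $R_0$. $A_i(\beta)$ is the $m\times m$ diagonal matrix with $j$th diagonal entry $A_{ij}(\beta)=\pi_{ij}(\beta)(1-\pi_{ij}(\beta))$, and $\varepsilon_i(\beta)=A_i^{-1/2}(\beta)(Y_i-\pi_i(\beta))$. $\widehat R$ is an estimated $m\times m$ working correlation matrix (random, and not depending on the argument $\beta_n$ of the estimating function). Define $$S_n(\beta_n)=\sum_{i=1}^nX_i^TA_i^{1/2}(\beta_n)\widehat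 R^{-1}A_i^{-1/2}(\beta_n)\big(Y_i-\pi_i(\beta_n)\big),$$ $$\overline M_n(\beta_n)=\sum_{i=1}^nX_i^TA_i^{1/2}(\beta_n)\overline R^{-1}R_0\overline R^{-1}A_i^{1/2}(\beta_n)X_i,\qquad \overline H_n(\beta_n)=\sum_{i=1}^nX_i^TA_i^{1/2}(\beta_n)\overline R^{-1}A_i^{1/2}(\beta_n)X_i,$$ $$\widehat M_n(\beta_n)=\sum_{i=1}^nX_i^TA_i^{1/2}(\beta_n)\widehat R^{-1}\varepsilon_i(\beta_n)\varepsilon_i^T(\beta_n)\widehat R^{-1}A_i^{1/2}(\beta_n)X_i,\qquad H_n(\beta_n)=\sum_{i=1}^nX_i^TA_i^{1/2}(\beta_n)\widehat R^{-1}A_i^{1/2}(\beta_n)X_i,$$ $$\Sigma_n=\overline H_n^{-1}(\beta_{n0})\overline M_n(\beta_{n0})\overline H_n^{-1}(\beta_{n0}),\qquad \widehat\Sigma_n=H_n^{-1}(\widehat\beta_n)\widehat M_n(\widehat\beta_n)H_n^{-1}(\widehat\beta_n)$$ (the latter is the sandwich covariance matrix estimator). $\|\cdot\|$ is the Euclidean norm for vectors and the Frobenius norm for matrices; $\lambda_{\min},\lambda_{\max}$ denote smallest and largest eigenvalues. *)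

(* Defs.v *)
From HB Require Import structures.
From mathcomp Require Import all_boot all_order all_algebra.
From mathcomp Require Import all_classical all_reals all_analysis.

Set Implicit Arguments.
Unset Strict Implicit.
Unset Printing Implicit Defensive.

Import Order.TTheory GRing.Theory Num.Theory.
Import numFieldNormedType.Exports.

Local Open Scope classical_set_scope.
Local Open Scope ring_scope.

(* On a row or column vector this is the Euclidean norm. *)
Definition frobenius_norm (R : realType) (a b : nat) (A : 'M[R]_(a, b)) : R :=
  Num.sqrt (\sum_(i < a) \sum_(j < b) A i j ^+ 2).

(* Only meaningful when the set of eigenvalues is nonempty, e.g. for a
   symmetric matrix of positive size. *)
Definition lambda_min (R : realType) (k : nat) (A : 'M[R]_k) : R :=
  inf [set a : R | eigenvalue A a].

Definition lambda_max (R : realType) (k : nat) (A : 'M[R]_k) : R :=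
  sup [set a : R | eigenvalue A a].

Definition positive_definite (R : realType) (k : nat) (A : 'M[R]_k) : Prop :=
  A^T = A /\ forall x : 'cV[R]_k, x != 0 -> 0 < (x^T *m A *m x) 0 0.

Definition correlation_matrix (R : realType) (k : nat) (A : 'M[R]_k) : Prop :=
  [/\ A^T = A,
      forall j : 'I_k, A j j = 1 &
      forall x : 'cV[R]_k, 0 <= (x^T *m A *m x) 0 0].

Definition correlation (R : realType) (d : measure_display)
    (T : measurableType d) (P : probability T R) (U V : T -> R) : R :=
  fine (covariance P U V) /
    (Num.sqrt (fine 'V_P[U]) * Num.sqrt (fine 'V_P[V])).

Definition mutually_independent (R : realType) (d : measure_display)
    (T : measurableType d) (P : probability T R) (d' : measure_display)
    (S : measurableType d') (I : finType) (Z : I -> T -> S) : Prop :=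
  forall (J : {set I}) (B : I -> set S), (forall i, measurable (B i)) ->
    P (\bigcap_(i in [set` J]) (Z i @^-1` B i)) =
    \big[*%E/1%E]_(i in J) P (Z i @^-1` B i).

(* Z = O_p(r) and Z = o_p(r), for nonnegative rates r, when the n-th variable
   lives on its own probability space. *)
Definition bigO_p (R : realType) (d : nat -> measure_display)
    (T : forall n, measurableType (d n)) (P : forall n, probability (T n) R)
    (Z : forall n, T n -> R) (r : nat -> R) : Prop :=
  forall e : R, 0 < e -> exists2 M : R, 0 < M &
    \forall n \near \oo,
      (P n [set w | (M * r n < `|Z n w|)%R] <= e%:E)%E.

Definition littleo_p (R : realType) (d : nat -> measure_display)
    (T : forall n, measurableType (d n)) (P : forall n, probability (T n) R)
    (Z : forall n, T n -> R) (r : nat -> R) : Prop :=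
  forall e : R, 0 < e ->
    (fun n => P n [set w | (e * r n < `|Z n w|)%R]) @ \oo --> 0%E.

(* For a fixed n: X i is the m x p matrix with rows X_ij^T, y i the response
   vector of cluster i, and W a working correlation matrix. *)

Definition pi_ (R : realType) (m p : nat) (Xi : 'M[R]_(m, p))
    (beta : 'cV[R]_p) : 'cV[R]_m :=
  \col_j (expR ((Xi *m beta) j 0) / (1 + expR ((Xi *m beta) j 0))).

Definition A_ (R : realType) (m p : nat) (Xi : 'M[R]_(m, p))
    (beta : 'cV[R]_p) (j : 'I_m) : R :=
  pi_ Xi beta j 0 * (1 - pi_ Xi beta j 0).

Definition A_half (R : realType) (m p : nat) (Xi : 'M[R]_(m, p))
    (beta : 'cV[R]_p) : 'M[R]_m :=
  diag_mx (\row_j Num.sqrt (A_ Xi beta j)).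

Definition A_neghalf (R : realType) (m p : nat) (Xi : 'M[R]_(m, p))
    (beta : 'cV[R]_p) : 'M[R]_m :=
  diag_mx (\row_j (Num.sqrt (A_ Xi beta j))^-1).

Definition epsilon_ (R : realType) (m p : nat) (Xi : 'M[R]_(m, p))
    (yi : 'cV[R]_m) (beta : 'cV[R]_p) : 'cV[R]_m :=
  A_neghalf Xi beta *m (yi - pi_ Xi beta).

Definition gee_score (R : realType) (n m p : nat) (X : 'I_n -> 'M[R]_(m, p))
    (y : 'I_n -> 'cV[R]_m) (W : 'M[R]_m) (beta : 'cV[R]_p) : 'cV[R]_p :=
  \sum_(i < n) (X i)^T *m A_half (X i) beta *m invmx W *m
    A_neghalf (X i) beta *m (y i - pi_ (X i) beta).

(* With W the limit of the working correlation this is \overline H_n; with W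
   the estimated working correlation it is H_n. *)
Definition H_ (R : realType) (n m p : nat) (X : 'I_n -> 'M[R]_(m, p))
    (W : 'M[R]_m) (beta : 'cV[R]_p) : 'M[R]_p :=
  \sum_(i < n) (X i)^T *m A_half (X i) beta *m invmx W *m
    A_half (X i) beta *m X i.

Definition Mbar (R : realType) (n m p : nat) (X : 'I_n -> 'M[R]_(m, p))
    (W R0 : 'M[R]_m) (beta : 'cV[R]_p) : 'M[R]_p :=
  \sum_(i < n) (X i)^T *m A_half (X i) beta *m invmx W *m R0 *m invmx W *m
    A_half (X i) beta *m X i.

Definition Mhat (R : realType) (n m p : nat) (X : 'I_n -> 'M[R]_(m, p))
    (y : 'I_n -> 'cV[R]_m) (W : 'M[R]_m) (beta : 'cV[R]_p) : 'M[R]_p :=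
  \sum_(i < n) (X i)^T *m A_half (X i) beta *m invmx W *m
    epsilon_ (X i) (y i) beta *m (epsilon_ (X i) (y i) beta)^T *m
    invmx W *m A_half (X i) beta *m X i.

Definition Sigma (R : realType) (n m p : nat) (X : 'I_n -> 'M[R]_(m, p))
    (W R0 : 'M[R]_m) (beta0 : 'cV[R]_p) : 'M[R]_p :=
  invmx (H_ X W beta0) *m Mbar X W R0 beta0 *m invmx (H_ X W beta0).

Definition Sigmahat (R : realType) (n m p : nat) (X : 'I_n -> 'M[R]_(m, p))
    (y : 'I_n -> 'cV[R]_m) (W : 'M[R]_m) (betahat : 'cV[R]_p) : 'M[R]_p :=
  invmx (H_ X W betahat) *m Mhat X y W betahat *m invmx (H_ X W betahat).

(* Main.v *)
Require Import Defs.
From HB Require Import structures.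
From mathcomp Require Import all_boot all_order all_algebra.
From mathcomp Require Import all_classical all_reals all_analysis.
From mathcomp Require Import measurable_realfun.
From mathcomp Require Import ring lra.

Set Implicit Arguments.
Unset Strict Implicit.
Unset Printing Implicit Defensive.

Import Order.TTheory GRing.Theory Num.Theory.
Import numFieldNormedType.Exports.

Local Open Scope classical_set_scope.
Local Open Scope ring_scope.

(** Why the sandwich estimator is consistent.

Multiplied by the number n of clusters, both covariance matrices are products
(H/n)^-1 (M/n) (H/n)^-1, and the argument compares the three factors in
operator norm.

The comparison is deterministic once three quantities are below some del: the
change of the inverse working correlation matrix, the change
|X_ij^T (betahat - beta0)| of every linear predictor, and the Frobenius norm of
the noise D = (Mhat - Mbar)/n evaluated at the true parameter and at the limit
Rbar of the working correlation matrix.  Each summand of H and M is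
X_i^T Z_i X_i with Z_i a product of a few m x m matrices that stay bounded and
move by O(del), because the fitted probabilities are bounded away from 0 and 1
([A_half_approximates], [epsilon_approximates]).  As (sum X_i^T X_i)/n is
bounded, averaging preserves such estimates ([approximates_cluster_sum]).  As it
is also bounded below, H/n is coercive ([H_coercive]), so that inversion
preserves them too ([approximates_invmx]).  The outcome is
[sandwich_perturbation]: the two covariance matrices differ by O(del)/n in
operator norm, and compressing by C_n, whose Frobenius norm is constant, keeps
this rate.

It remains to make del small with high probability.  The inverse working
correlation matrix moves by O_p(sqrt(p/n)).  Covariate vectors having norm
O(sqrt p), a linear predictor moves by at most O(sqrt p) |betahat - beta0|, that
is by O_p(p / sqrt n).  Finally D is an average of n independent centred
matrices, of Frobenius norm O(p) for the same reason; hence E |D|^2 is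
O(p^2 / n) and Markov's inequality applies ([mean_sqr_noise_le], [noise_tail]).
Independence enters only through products of two responses: these are
indicators of events, and events of distinct clusters are independent
([response_products_uncorrelated]).  All three rates vanish since
p / n <= p^2 / n <= p^3 / n -> 0.

The probabilities in O_p and o_p are measures of explicit sets, and a measure
is monotone on measurable sets only, which is why the estimators are shown to
be measurable functions of the data ([measurable_Sigmahat]). *)

(** * The Frobenius norm *)

(** A quadratic polynomial in t that is never negative has nonpositive
    discriminant: evaluate it at its minimiser - b / c. When c = 0 the
    polynomial is affine, and the value -1 is taken unless b = 0. *)
Lemma discriminant_le (R : realFieldType) (a b c : R) : 0 <= c ->
  (forall t, 0 <= a + 2 * t * b + t ^+ 2 * c) -> b ^+ 2 <= a * c.
Proof.
rewrite le_eqVlt => /orP[/eqP <- h|c0 h].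
  have [->|b0] := eqVneq b 0; first by rewrite expr0n mulr0.
  (* The root of a + 1 + 2 t b. *)
  have := h (- (a + 1) / (2 * b)).
  have -> : a + 2 * (- (a + 1) / (2 * b)) * b + (- (a + 1) / (2 * b)) ^+ 2 * 0
    = -1 by field.
  by rewrite oppr_ge0 ler10.
have := h (- b / c).
have -> : a + 2 * (- b / c) * b + (- b / c) ^+ 2 * c = (a * c - b ^+ 2) / c.
  by field; rewrite gt_eqF.
by rewrite pmulr_lge0 ?invr_gt0 // subr_ge0.
Qed.

Section FrobeniusNorm.
Variable R : realType.

Lemma sum_mul_sqr_le (I : finType) (f g : I -> R) :
  (\sum_i f i * g i) ^+ 2 <= (\sum_i f i ^+ 2) * (\sum_i g i ^+ 2).
Proof.
apply: discriminant_le; first by apply: sumr_ge0 => i _; exact: sqr_ge0.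
move=> t; have -> : \sum_i f i ^+ 2 + 2 * t * (\sum_i f i * g i) +
    t ^+ 2 * (\sum_i g i ^+ 2) = \sum_i (f i + t * g i) ^+ 2.
  rewrite !mulr_sumr -!big_split /=; apply: eq_bigr => i _; ring.
by apply: sumr_ge0 => i _; exact: sqr_ge0.
Qed.

Lemma frobenius_norm_ge0 a b (A : 'M[R]_(a, b)) : 0 <= frobenius_norm A.
Proof. exact: sqrtr_ge0. Qed.

Lemma sqr_frobenius_norm a b (A : 'M[R]_(a, b)) :
  frobenius_norm A ^+ 2 = \sum_i \sum_j A i j ^+ 2.
Proof.
by rewrite sqr_sqrtr //; do 2!apply: sumr_ge0 => ? _; exact: sqr_ge0.
Qed.

Lemma sqr_frobenius_norm_pair a b (A : 'M[R]_(a, b)) :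
  frobenius_norm A ^+ 2 = \sum_(i : 'I_a * 'I_b) A i.1 i.2 ^+ 2.
Proof. by rewrite sqr_frobenius_norm pair_bigA. Qed.

Lemma sqr_frobenius_norm_col a (x : 'cV[R]_a) :
  frobenius_norm x ^+ 2 = \sum_i x i 0 ^+ 2.
Proof.
by rewrite sqr_frobenius_norm; apply: eq_bigr => i _; rewrite big_ord1.
Qed.

Lemma sqr_frobenius_norm_dot a (x : 'cV[R]_a) :
  frobenius_norm x ^+ 2 = (x^T *m x) 0 0.
Proof.
rewrite sqr_frobenius_norm_col mxE; apply: eq_bigr => i _.
by rewrite mxE expr2.
Qed.

Lemma frobenius_norm_le a b (A : 'M[R]_(a, b)) (k : R) : 0 <= k ->
  frobenius_norm A ^+ 2 <= k ^+ 2 -> frobenius_norm A <= k.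
Proof. by move=> k0; rewrite ler_sqr ?nnegrE ?frobenius_norm_ge0. Qed.

Lemma frobenius_norm_tr a b (A : 'M[R]_(a, b)) :
  frobenius_norm A^T = frobenius_norm A.
Proof.
congr Num.sqrt; rewrite exchange_big; apply: eq_bigr => i _.
by apply: eq_bigr => j _; rewrite mxE.
Qed.

Lemma frobenius_normZ a b k (A : 'M[R]_(a, b)) :
  frobenius_norm (k *: A) = `|k| * frobenius_norm A.
Proof.
rewrite /frobenius_norm -sqrtr_sqr -sqrtrM ?sqr_ge0 //; congr Num.sqrt.
rewrite mulr_sumr; apply: eq_bigr => i _; rewrite mulr_sumr.
by apply: eq_bigr => j _; rewrite mxE exprMn.
Qed.

Lemma frobenius_norm0 a b : frobenius_norm (0 : 'M[R]_(a, b)) = 0.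
Proof. by rewrite -(scale0r 0) frobenius_normZ normr0 mul0r. Qed.

Lemma frobenius_norm_eq0 a b (A : 'M[R]_(a, b)) :
  frobenius_norm A = 0 -> A = 0.
Proof.
move=> A0; apply/matrixP => i j; rewrite mxE; apply/eqP.
rewrite -sqrf_eq0; have := sqr_frobenius_norm A.
rewrite A0 expr0n /= => /esym/eqP.
rewrite psumr_eq0 => [/allP/(_ i)|k _]; last first.
  by apply: sumr_ge0 => ? _; exact: sqr_ge0.
rewrite mem_index_enum => /(_ isT) /=; rewrite psumr_eq0 => [/allP/(_ j)|k _].
  by rewrite mem_index_enum => /(_ isT).
exact: sqr_ge0.
Qed.

Lemma frobenius_normD a b (A B : 'M[R]_(a, b)) :
  frobenius_norm (A + B) <= frobenius_norm A + frobenius_norm B.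
Proof.
have A0 := frobenius_norm_ge0 A; have B0 := frobenius_norm_ge0 B.
apply: frobenius_norm_le; first exact: addr_ge0.
set S := \sum_(i : 'I_a * 'I_b) A i.1 i.2 * B i.1 i.2.
have SAB : S <= frobenius_norm A * frobenius_norm B.
  apply: le_trans (ler_norm _) _.
  rewrite -ler_sqr ?nnegrE ?mulr_ge0 // real_normK ?num_real // exprMn.
  by rewrite !sqr_frobenius_norm_pair sum_mul_sqr_le.
have -> : frobenius_norm (A + B) ^+ 2 =
    frobenius_norm A ^+ 2 + 2 * S + frobenius_norm B ^+ 2.
  rewrite !sqr_frobenius_norm_pair mulr_sumr -!big_split /=.
  by apply: eq_bigr => i _; rewrite mxE; ring.
by rewrite sqrrD -mulr_natl; lra.
Qed.

Lemma frobenius_normM a b c (A : 'M[R]_(a, b)) (B : 'M[R]_(b, c)) :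
  frobenius_norm (A *m B) <= frobenius_norm A * frobenius_norm B.
Proof.
apply: frobenius_norm_le; first by rewrite mulr_ge0 ?frobenius_norm_ge0.
rewrite exprMn -(frobenius_norm_tr B) !sqr_frobenius_norm mulr_suml.
apply: ler_sum => i _; rewrite mulr_sumr; apply: ler_sum => k _.
rewrite mxE; under [X in _ <= _ * X]eq_bigr do rewrite mxE.
exact: sum_mul_sqr_le.
Qed.

Lemma dot_le a (x y : 'cV[R]_a) :
  `|(x^T *m y) 0 0| <= frobenius_norm x * frobenius_norm y.
Proof.
rewrite -ler_sqr ?nnegrE ?mulr_ge0 ?frobenius_norm_ge0 //.
rewrite real_normK ?num_real // exprMn !sqr_frobenius_norm_col mxE.
by under eq_bigr do rewrite mxE; exact: sum_mul_sqr_le.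
Qed.

Lemma entry_le a b (A : 'M[R]_(a, b)) i j : `|A i j| <= frobenius_norm A.
Proof.
rewrite -ler_sqr ?nnegrE ?frobenius_norm_ge0 // real_normK ?num_real //.
rewrite sqr_frobenius_norm (bigD1 i) //= (bigD1 j) //=.
rewrite -addrA lerDl addr_ge0 //; do !apply: sumr_ge0 => *; exact: sqr_ge0.
Qed.

Lemma frobenius_norm_le_entry a b (A : 'M[R]_(a, b)) k : 0 <= k ->
  (forall i j, `|A i j| <= k) -> frobenius_norm A <= (a * b)%:R * k.
Proof.
move=> k0 Ak; apply: frobenius_norm_le; first by rewrite mulr_ge0.
apply: (@le_trans _ _ ((a * b)%:R * k ^+ 2)).
  rewrite sqr_frobenius_norm_pair.
  apply: (@le_trans _ _ (\sum_(i : 'I_a * 'I_b) k ^+ 2)).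
    by apply: ler_sum => i _; rewrite -real_normK ?num_real // ler_sqr ?nnegrE.
  by rewrite sumr_const card_prod !card_ord mulr_natl.
rewrite exprMn ler_wpM2r ?sqr_ge0 // -natrX ler_nat.
by case: (a * b)%N => // c; rewrite leq_pmulr.
Qed.

(** * Quadratic forms and extreme eigenvalues *)

Definition quadratic_form k (A : 'M[R]_k) (x : 'cV[R]_k) : R :=
  (x^T *m A *m x) 0 0.

Lemma quadratic_form_le k (A : 'M[R]_k) x :
  `|quadratic_form A x| <= frobenius_norm A * frobenius_norm x ^+ 2.
Proof.
rewrite /quadratic_form -mulmxA; apply: le_trans (dot_le _ _) _.
rewrite expr2 mulrCA ler_wpM2l ?frobenius_norm_ge0 //; exact: frobenius_normM.
Qed.

Lemma quadratic_formD k (A B : 'M[R]_k) x :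
  quadratic_form (A + B) x = quadratic_form A x + quadratic_form B x.
Proof. by rewrite /quadratic_form mulmxDr mulmxDl mxE. Qed.

Lemma quadratic_formZ k c (A : 'M[R]_k) x :
  quadratic_form (c *: A) x = c * quadratic_form A x.
Proof. by rewrite /quadratic_form -scalemxAr -scalemxAl mxE. Qed.

Lemma quadratic_formZv k c (A : 'M[R]_k) x :
  quadratic_form A (c *: x) = c ^+ 2 * quadratic_form A x.
Proof.
rewrite /quadratic_form [(c *: x)^T]linearZ /= -!scalemxAl -scalemxAr !mxE.
by rewrite mulrA expr2.
Qed.

Lemma quadratic_form_scalar k c (x : 'cV[R]_k) :
  quadratic_form c%:M x = c * frobenius_norm x ^+ 2.
Proof.
by rewrite sqr_frobenius_norm_dot /quadratic_form mul_mx_scalar -scalemxAl mxE.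
Qed.

Lemma psd_cauchy_schwarz k (A : 'M[R]_k) (x y : 'cV[R]_k) : A^T = A ->
  (forall z, 0 <= quadratic_form A z) ->
  (x^T *m A *m y) 0 0 ^+ 2 <= quadratic_form A x * quadratic_form A y.
Proof.
move=> symA psdA; apply: discriminant_le => // t.
have yx : (y^T *m A *m x) 0 0 = (x^T *m A *m y) 0 0.
  have -> : y^T *m A *m x = (x^T *m A *m y)^T.
    by rewrite !trmx_mul symA trmxK mulmxA.
  by rewrite mxE.
have := psdA (x + t *: y); rewrite /quadratic_form.
rewrite [(x + _)^T]linearD /= [(t *: y)^T]linearZ /= !(mulmxDl, mulmxDr).
have mx1D (M N : 'M[R]_1) : (M + N) 0 0 = M 0 0 + N 0 0 by rewrite mxE.
have mx1Z a (M : 'M[R]_1) : (a *: M) 0 0 = a * M 0 0 by rewrite mxE.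
by rewrite -!scalemxAl -!scalemxAr !(mx1D, mx1Z) yx; congr (0 <= _); ring.
Qed.

(** Apply the Cauchy-Schwarz inequality of the form of A to x and y = A^-1 x:
    the mixed term is |x|^2 and the form at y is the form of A^-1 at x, which is
    at most |A^-1| |x|^2. This replaces any appeal to compactness of the sphere. *)
Lemma psd_invertible_coercive k (A : 'M[R]_k) (x : 'cV[R]_k) : A^T = A ->
  (forall z, 0 <= quadratic_form A z) -> A \in unitmx ->
  frobenius_norm x ^+ 2 <= frobenius_norm (invmx A) * quadratic_form A x.
Proof.
move=> symA psdA uA; set y := invmx A *m x.
have := psd_cauchy_schwarz x y symA psdA.
rewrite [in X in X -> _]/quadratic_form.
have -> : x^T *m A *m y = x^T *m x by rewrite /y mulmxA mulmxK.
rewrite -[y^T *m A *m y]mulmxA [A *m y]mulmxA mulmxV // mul1mx.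
rewrite -sqr_frobenius_norm_dot -/(quadratic_form A x) => h.
have hy : (y^T *m x) 0 0 <= frobenius_norm (invmx A) * frobenius_norm x ^+ 2.
  apply: le_trans (ler_norm _) _; apply: le_trans (dot_le _ _) _.
  by rewrite expr2 mulrA ler_wpM2r ?frobenius_norm_ge0 ?frobenius_normM.
have {}h := le_trans h (ler_wpM2l (psdA x) hy).
have := sqr_ge0 (frobenius_norm x); rewrite le_eqVlt => /orP[/eqP<-|x0].
  by rewrite mulr_ge0 ?frobenius_norm_ge0.
rewrite -(ler_pM2r x0) -expr2; apply: le_trans h _.
by rewrite mulrA [quadratic_form A x * _]mulrC.
Qed.

(** The infimum lam of the Rayleigh quotient is an eigenvalue: A - lam is
    positive semidefinite, and if it were invertible it would be coercive by
    [psd_invertible_coercive], so that the quotient would stay above lam + |(A -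
    lam)^-1|^-1. Every eigenvalue being at least lam, the set of eigenvalues is
    bounded below and its infimum is at most lam. *)
Lemma lambda_min_quadratic k (A : 'M[R]_k) c x : A^T = A ->
  c <= lambda_min A -> c * frobenius_norm x ^+ 2 <= quadratic_form A x.
Proof.
move=> symA cA; case: k => [|k] in A x symA cA *.
  by rewrite sqr_frobenius_norm_col big_ord0 mulr0 /quadratic_form mxE big_ord0.
pose S := [set quadratic_form A z | z in [set z | frobenius_norm z = 1]].
have S0 : S !=set0.
  exists (quadratic_form A (delta_mx 0 0)), (delta_mx 0 0) => //=.
  apply/eqP; rewrite -sqrp_eq1 ?frobenius_norm_ge0 // sqr_frobenius_norm_col.
  rewrite (bigD1 0) //= mxE !eqxx expr1n big1 ?addr0 // => i i0.
  by rewrite mxE (negbTE i0) expr0n.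
have lbS : has_lbound S.
  exists (- frobenius_norm A) => _ [z /= z1 <-].
  have := quadratic_form_le A z; rewrite z1 expr1n mulr1 ler_norml.
  by case/andP.
set lam := inf S; pose N := A - lam%:M.
have symN : N^T = N by rewrite /N linearB /= symA tr_scalar_mx.
have NE z : quadratic_form N z =
    quadratic_form A z - lam * frobenius_norm z ^+ 2.
  rewrite /N -scaleN1r quadratic_formD quadratic_formZ quadratic_form_scalar.
  by rewrite mulN1r.
have rayleigh z : lam * frobenius_norm z ^+ 2 <= quadratic_form A z.
  have [->|z0] := eqVneq z 0.
    by rewrite frobenius_norm0 expr0n mulr0 /quadratic_form mulmx0 mxE.
  have nz : 0 < frobenius_norm z.
    rewrite lt_def frobenius_norm_ge0 andbT.
    by apply: contra_neq z0; exact: frobenius_norm_eq0.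
  have : lam <= quadratic_form A ((frobenius_norm z)^-1 *: z).
    apply: ge_inf => //; exists ((frobenius_norm z)^-1 *: z) => //=.
    by rewrite frobenius_normZ gtr0_norm ?invr_gt0 // mulVf // gt_eqF.
  rewrite quadratic_formZv exprVn -ler_pdivrMl ?invr_gt0 ?exprn_gt0 //.
  by rewrite invrK mulrC.
apply: le_trans (rayleigh x); apply: ler_wpM2r; first exact: sqr_ge0.
apply: le_trans cA _.
have eig_ge a : eigenvalue A a -> lam <= a.
  move=> /eigenvalueP[v vA v0].
  have := rayleigh v^T; rewrite /quadratic_form trmxK vA -scalemxAl mxE.
  rewrite -{2}[v]trmxK -sqr_frobenius_norm_dot ler_pM2r //.
  rewrite exprn_gt0 // lt_def frobenius_norm_ge0 andbT frobenius_norm_tr.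
  by apply: contra_neq v0; exact: frobenius_norm_eq0.
apply: ge_inf; first by exists lam => a /eig_ge.
have [uN|] := boolP (N \in unitmx); last first.
  rewrite unitmxE unitfE negbK => /det0P[v v0 vN].
  apply/eigenvalueP; exists v => //; apply/eqP.
  by rewrite -subr_eq0 -mul_mx_scalar -mulmxBr; apply/eqP.
exfalso; have psdN z : 0 <= quadratic_form N z by rewrite NE subr_ge0.
have coer z := psd_invertible_coercive z symN psdN uN.
set M := frobenius_norm (invmx N) in coer.
have M0 : 0 < M.
  rewrite lt_def frobenius_norm_ge0 andbT; apply/eqP => M0.
  have [_ [z z1 _]] := S0.
  by have := coer z; rewrite M0 z1 mul0r expr1n ler10.
have : lam + M^-1 <= lam.
  apply: lb_le_inf => // _ [z /= z1 <-].
  have := coer z; rewrite NE z1 expr1n mulr1 -ler_pdivrMl // mulr1; lra.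
by rewrite gerDl leNgt invr_gt0 M0.
Qed.

Lemma lambda_max_quadratic k (A : 'M[R]_k) c x : A^T = A ->
  lambda_max A <= c -> quadratic_form A x <= c * frobenius_norm x ^+ 2.
Proof.
move=> symA Ac; suff: - c * frobenius_norm x ^+ 2 <= quadratic_form (- A) x.
  by rewrite -[- A]scaleN1r quadratic_formZ mulN1r mulNr lerN2.
apply: lambda_min_quadratic; first by rewrite linearN /= symA.
rewrite /lambda_min /inf lerN2; apply: le_trans Ac.
rewrite le_eqVlt; apply/orP; left; apply/eqP; congr sup.
have eigN (B : 'M[R]_k) a : eigenvalue B a -> eigenvalue (- B) (- a).
  move=> /eigenvalueP[v vB v0]; apply/eigenvalueP; exists v => //.
  by rewrite mulmxN vB scaleNr.
apply/seteqP; split=> [_ [a /= /eigN Aa <-]|a /eigN Aa].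
  by rewrite /= -[A]opprK.
by exists (- a); rewrite ?opprK.
Qed.

End FrobeniusNorm.

(** * Operator bounds and a calculus of first-order perturbations *)

Section OperatorBounds.
Variable R : realType.

(** [K] dominates the operator norm of [N] for the Euclidean norms. *)
Definition operator_bound a b (N : 'M[R]_(a, b)) (K : R) : Prop :=
  forall x : 'cV[R]_b, frobenius_norm (N *m x) <= K * frobenius_norm x.

Lemma operator_bound_frobenius a b (N : 'M[R]_(a, b)) K :
  frobenius_norm N <= K -> operator_bound N K.
Proof.
move=> NK x; apply: le_trans (frobenius_normM _ _) _.
by rewrite ler_wpM2r ?frobenius_norm_ge0.
Qed.

Lemma operator_bound_le a b (N : 'M[R]_(a, b)) K L :
  K <= L -> operator_bound N K -> operator_bound N L.
Proof.
move=> KL NK x; apply: le_trans (NK x) _.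
by rewrite ler_wpM2r ?frobenius_norm_ge0.
Qed.

Lemma operator_boundM a b c (N : 'M[R]_(a, b)) (M : 'M[R]_(b, c)) K L :
  0 <= K -> operator_bound N K -> operator_bound M L ->
  operator_bound (N *m M) (K * L).
Proof.
move=> K0 NK ML x; rewrite -mulmxA; apply: le_trans (NK _) _.
by rewrite -mulrA ler_wpM2l.
Qed.

Lemma operator_boundD a b (N M : 'M[R]_(a, b)) K L :
  operator_bound N K -> operator_bound M L -> operator_bound (N + M) (K + L).
Proof.
move=> NK ML x; rewrite mulmxDl mulrDl; apply: le_trans (frobenius_normD _ _) _.
by rewrite lerD.
Qed.

(** Test the bilinear form at y = N x. *)
Lemma operator_bound_form a b (N : 'M[R]_(a, b)) K : 0 <= K ->
  (forall (x : 'cV[R]_b) (y : 'cV[R]_a), `|(y^T *m N *m x) 0 0| <=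
     K * (frobenius_norm y * frobenius_norm x)) -> operator_bound N K.
Proof.
move=> K0 NK x; have := NK x (N *m x).
rewrite -mulmxA -sqr_frobenius_norm_dot ger0_norm ?sqr_ge0 //.
have := frobenius_norm_ge0 (N *m x); rewrite le_eqVlt => /orP[/eqP <- _|Nx0].
  by rewrite mulr_ge0 ?frobenius_norm_ge0.
by rewrite mulrCA expr2 ler_pM2l.
Qed.

(** The form of the sum at (y, x) is at most K sum |X_i y| |X_i x|; the
    Cauchy-Schwarz inequality over i separates the two factors, and each is
    controlled by the hypothesis on sum |X_i x|^2. *)
Lemma operator_bound_cluster_sum n m p (X : 'I_n -> 'M[R]_(m, p))
    (Z : 'I_n -> 'M[R]_m) b K : (0 < n)%N -> 0 <= b -> 0 <= K ->
  (forall x : 'cV[R]_p, n%:R^-1 * \sum_i frobenius_norm (X i *m x) ^+ 2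
     <= b * frobenius_norm x ^+ 2) ->
  (forall i, operator_bound (Z i) K) ->
  operator_bound (n%:R^-1 *: \sum_i (X i)^T *m Z i *m X i) (b * K).
Proof.
move=> n0 b0 K0 Xb ZK; apply: operator_bound_form => [|x y].
  exact: mulr_ge0.
have nR : 0 < n%:R :> R by rewrite ltr0n.
have fn0 (z : 'cV[R]_p) i : 0 <= frobenius_norm (X i *m z).
  exact: frobenius_norm_ge0.
have -> : y^T *m (n%:R^-1 *: \sum_i (X i)^T *m Z i *m X i) *m x =
    n%:R^-1 *: \sum_i (X i *m y)^T *m (Z i *m (X i *m x)).
  rewrite -scalemxAr -scalemxAl mulmx_sumr mulmx_suml; congr (_ *: _).
  by apply: eq_bigr => i _; rewrite trmx_mul !mulmxA.
rewrite mxE summxE normrM gtr0_norm ?invr_gt0 // ler_pdivrMl //.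
pose S := \sum_i frobenius_norm (X i *m y) * frobenius_norm (X i *m x).
apply: (@le_trans _ _ (K * S)).
  apply: le_trans (ler_norm_sum _ _ _) _; rewrite mulr_sumr.
  apply: ler_sum => i _; apply: le_trans (dot_le _ _) _.
  by rewrite mulrCA ler_wpM2l // ZK.
have -> : n%:R * (b * K * (frobenius_norm y * frobenius_norm x)) =
  K * (n%:R * b * (frobenius_norm y * frobenius_norm x)) by ring.
apply: ler_wpM2l => //.
have S0 : 0 <= S by apply: sumr_ge0 => i _; rewrite mulr_ge0.
rewrite -ler_sqr ?nnegrE // ?mulr_ge0 ?frobenius_norm_ge0 // ?ler0n //.
apply: le_trans (sum_mul_sqr_le _ _) _.
have {}Xb (z : 'cV[R]_p) : \sum_i frobenius_norm (X i *m z) ^+ 2 <=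
    n%:R * (b * frobenius_norm z ^+ 2) by rewrite -ler_pdivrMl //; exact: Xb.
apply: le_trans (ler_pM _ _ (Xb y) (Xb x)) _.
- by apply: sumr_ge0 => i _; exact: sqr_ge0.
- by apply: sumr_ge0 => i _; exact: sqr_ge0.
by rewrite le_eqVlt; apply/orP; left; apply/eqP; ring.
Qed.

Lemma coercive_unitmx k (N : 'M[R]_k) r : 0 < r ->
  (forall x, r * frobenius_norm x ^+ 2 <= quadratic_form N x) -> N \in unitmx.
Proof.
move=> r0 Nr; rewrite unitmxE unitfE; apply/det0P => -[v v0 vN].
have := Nr v^T; rewrite /quadratic_form trmxK vN mul0mx mxE pmulr_rle0 //.
rewrite le_eqVlt ltNge sqr_ge0 orbF sqrf_eq0 frobenius_norm_tr => /eqP.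
by move=> /frobenius_norm_eq0 v00; rewrite v00 eqxx in v0.
Qed.

Lemma coercive_invmx_bound k (N : 'M[R]_k) r : 0 < r ->
  (forall x, r * frobenius_norm x ^+ 2 <= quadratic_form N x) ->
  operator_bound (invmx N) r^-1.
Proof.
move=> r0 Nr; have uN := coercive_unitmx r0 Nr; move=> x.
set y := invmx N *m x; rewrite ler_pdivlMl //.
have := Nr y; rewrite /quadratic_form -mulmxA [N *m y]mulmxA mulmxV // mul1mx.
move=> /le_trans/(_ (le_trans (ler_norm _) (dot_le _ _))).
have := frobenius_norm_ge0 y; rewrite le_eqVlt => /orP[/eqP <- _|y0].
  by rewrite mulr0 frobenius_norm_ge0.
by rewrite expr2 mulrCA ler_pM2l.
Qed.

(** [N'] differs from [N] to first order in [del]. A single constant [K] bounds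
    both [N] and the rate of change, so that products, inverses and cluster
    averages are handled by composing constants. *)
Definition approximates a b (del K : R) (N' N : 'M[R]_(a, b)) : Prop :=
  [/\ 0 <= K, operator_bound N K & operator_bound (N' - N) (K * del)].

Section Calculus.
Variable del : R.
Hypotheses (del0 : 0 <= del) (del1 : del <= 1).

Lemma approximates_frobenius a b K (N' N : 'M[R]_(a, b)) :
  frobenius_norm N <= K -> frobenius_norm (N' - N) <= K * del ->
  approximates del K N' N.
Proof.
move=> NK dN; split; first exact: le_trans (frobenius_norm_ge0 _) NK.
  exact: operator_bound_frobenius.
exact: operator_bound_frobenius.
Qed.

(** Expand N' M' - N M into first-order terms and the product of the two
    increments; since del <= 1, this product is also of first order, whence the
    factor 3. *)
Lemma approximatesM a b c K L (N' N : 'M[R]_(a, b)) (M' M : 'M[R]_(b, c)) :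
  approximates del K N' N -> approximates del L M' M ->
  approximates del (3 * K * L) (N' *m M') (N *m M).
Proof.
move=> [K0 NK dN] [L0 ML dM]; have KL0 := mulr_ge0 K0 L0.
split; first by rewrite -mulrA mulr_ge0.
  apply: operator_bound_le (operator_boundM K0 NK ML).
  by rewrite -mulrA; lra.
have -> : N' *m M' - N *m M =
    (N' - N) *m (M' - M) + ((N' - N) *m M + N *m (M' - M)).
  rewrite !(mulmxBl, mulmxBr); move: (N' *m M') (N' *m M) (N *m M') (N *m M).
  by move=> e f g h; apply/matrixP => i j; rewrite !mxE; ring.
have Kd0 : 0 <= K * del by rewrite mulr_ge0.
apply: operator_bound_le (operator_boundD (operator_boundM Kd0 dN dM)
  (operator_boundD (operator_boundM Kd0 dN ML) (operator_boundM K0 NK dM))).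
have h : K * L * del * del <= K * L * del by rewrite ler_piMr // mulr_ge0.
have -> : K * del * (L * del) + (K * del * L + K * (L * del)) =
  K * L * del * del + 2 * (K * L * del) by ring.
have -> : 3 * K * L * del = K * L * del + 2 * (K * L * del) by ring.
by rewrite lerD2r.
Qed.

Lemma approximates_shift a b K (N' N M : 'M[R]_(a, b)) :
  approximates del K N' N -> operator_bound (N - M) del ->
  approximates del (K + 1) N' M.
Proof.
move=> [K0 NK dN] dM; split; first exact: addr_ge0.
  have -> : M = N + - 1 *: (N - M) by rewrite scaleN1r opprB addrC subrK.
  apply: (operator_boundD NK) => x.
  rewrite -scalemxAl frobenius_normZ normrN1 mul1r.
  by apply: le_trans (dM x) _; rewrite ler_wpM2r ?frobenius_norm_ge0.
have -> : N' - M = (N' - N) + (N - M) by rewrite addrA subrK.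
by rewrite mulrDl mul1r; exact: operator_boundD.
Qed.

Lemma approximates_cluster_sum n m p (X : 'I_n -> 'M[R]_(m, p))
    (Z' Z : 'I_n -> 'M[R]_m) b K : (0 < n)%N -> 0 <= b -> 0 <= K ->
  (forall x : 'cV[R]_p, n%:R^-1 * \sum_i frobenius_norm (X i *m x) ^+ 2
     <= b * frobenius_norm x ^+ 2) ->
  (forall i, approximates del K (Z' i) (Z i)) ->
  approximates del (b * K) (n%:R^-1 *: \sum_i (X i)^T *m Z' i *m X i)
    (n%:R^-1 *: \sum_i (X i)^T *m Z i *m X i).
Proof.
move=> n0 b0 K0 Xb ZZ; split; first exact: mulr_ge0.
  by apply: operator_bound_cluster_sum => // i; case: (ZZ i).
rewrite -scalerBr -sumrB -mulrA.
have -> : \sum_i ((X i)^T *m Z' i *m X i - (X i)^T *m Z i *m X i) =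
    \sum_i (X i)^T *m (Z' i - Z i) *m X i.
  by apply: eq_bigr => i _; rewrite mulmxBr mulmxBl.
apply: operator_bound_cluster_sum => // [|i]; first exact: mulr_ge0.
by case: (ZZ i).
Qed.

Lemma approximates_coercive k K r (N' N : 'M[R]_k) x :
  approximates del K N' N -> K * del <= r / 2 ->
  (forall x, r * frobenius_norm x ^+ 2 <= quadratic_form N x) ->
  r / 2 * frobenius_norm x ^+ 2 <= quadratic_form N' x.
Proof.
move=> [K0 _ dN] Kr Nr.
have -> : N' = N + (N' - N) by rewrite addrC subrK.
rewrite quadratic_formD; have := Nr x.
have : `|quadratic_form (N' - N) x| <= r / 2 * frobenius_norm x ^+ 2.
  rewrite /quadratic_form -mulmxA; apply: le_trans (dot_le _ _) _.
  rewrite expr2 mulrCA ler_wpM2l ?frobenius_norm_ge0 //.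
  by apply: le_trans (dN x) _; rewrite ler_wpM2r ?frobenius_norm_ge0.
rewrite ler_norml; set f := frobenius_norm x ^+ 2.
by move=> /andP[+ _]; lra.
Qed.

(** The increment of the inverse is N'^-1 (N - N') N^-1. A perturbation by at
    most r / 2 keeps half of the coercivity constant r of N, which bounds the
    first factor by 2 / r and the last by 1 / r. *)
Lemma approximates_invmx k K r (N' N : 'M[R]_k) : 0 < r ->
  (forall x, r * frobenius_norm x ^+ 2 <= quadratic_form N x) ->
  approximates del K N' N -> K * del <= r / 2 ->
  approximates del (r^-1 + 2 * K / r ^+ 2) (invmx N') (invmx N).
Proof.
move=> r0 Nr NN Kr; have [K0 _ dN] := NN.
have N'r x := approximates_coercive x NN Kr Nr.
have r20 : 0 < r / 2 by rewrite divr_gt0.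
have uN := coercive_unitmx r0 Nr; have uN' := coercive_unitmx r20 N'r.
have bN := coercive_invmx_bound r0 Nr.
have bN' := coercive_invmx_bound r20 N'r.
have Kr0 : 0 <= 2 * K / r ^+ 2 by rewrite !mulr_ge0 // invr_ge0 sqr_ge0.
have ri0 : 0 <= r^-1 by rewrite invr_ge0 ltW.
split; first exact: addr_ge0.
  by apply: operator_bound_le bN; rewrite lerDl.
have -> : invmx N' - invmx N = invmx N' *m (- 1 *: (N' - N)) *m invmx N.
  rewrite scaleN1r opprB mulmxBr mulmxBl mulVmx // mul1mx.
  by rewrite -mulmxA mulmxV // mulmx1.
have {}dN : operator_bound (- 1 *: (N' - N)) (K * del).
  by move=> x; rewrite -scalemxAl frobenius_normZ normrN1 mul1r.
have r20' : 0 <= (r / 2)^-1 by rewrite invr_ge0 ltW.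
have Kd0 : 0 <= K * del by exact: mulr_ge0.
apply: operator_bound_le
  (operator_boundM (mulr_ge0 r20' Kd0) (operator_boundM r20' bN' dN) bN).
have -> : (r / 2)^-1 * (K * del) * r^-1 = 2 * K / r ^+ 2 * del.
  by field; rewrite gt_eqF.
by rewrite ler_wpM2r // lerDr.
Qed.

End Calculus.
Lemma operator_bound_mulmx a b c (N : 'M[R]_(a, b))
    (B : 'M[R]_(b, c)) K : 0 <= K -> operator_bound N K ->
  frobenius_norm (N *m B) <= K * frobenius_norm B.
Proof.
move=> K0 NK; apply: frobenius_norm_le.
  by rewrite mulr_ge0 ?frobenius_norm_ge0.
have colsE k (A : 'M[R]_(k, c)) :
    frobenius_norm A ^+ 2 = \sum_j frobenius_norm (col j A) ^+ 2.
  rewrite sqr_frobenius_norm exchange_big; apply: eq_bigr => j _.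
  by rewrite sqr_frobenius_norm_col; apply: eq_bigr => i _; rewrite mxE.
rewrite exprMn !colsE mulr_sumr; apply: ler_sum => j _.
rewrite !colE -mulmxA -exprMn ler_sqr ?nnegrE ?mulr_ge0 ?frobenius_norm_ge0 //.
Qed.

Lemma frobenius_norm_congruenceB l p (C : 'M[R]_(l, p))
    (N' N : 'M[R]_p) c K : 0 < c -> 0 <= K ->
  operator_bound (c *: (N' - N)) K ->
  frobenius_norm (C *m N' *m C^T - C *m N *m C^T) <=
    c^-1 * (K * frobenius_norm C ^+ 2).
Proof.
move=> c0 K0 NK.
have -> : C *m N' *m C^T - C *m N *m C^T =
    c^-1 *: (C *m (c *: (N' - N) *m C^T)).
  rewrite -scalemxAl -scalemxAr scalerA mulVf ?gt_eqF // scale1r.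
  by rewrite mulmxA mulmxBr mulmxBl.
rewrite frobenius_normZ gtr0_norm ?invr_gt0 // ler_wpM2l ?invr_ge0 ?(ltW c0) //.
apply: le_trans (frobenius_normM _ _) _.
apply: le_trans
  (ler_wpM2l (frobenius_norm_ge0 _) (operator_bound_mulmx _ K0 NK)) _.
by rewrite frobenius_norm_tr mulrCA -expr2.
Qed.

End OperatorBounds.

(** * The logistic model in terms of the square root of the odds *)

Section Logistic.
Variable R : realType.

(** Both bounds come from 1 + x <= exp x, used at s and, for the upper one, at -
    s. *)
Lemma expR_sub1_le (s : R) : `|s| <= 1 / 2 -> `|expR s - 1| <= 2 * `|s|.
Proof.
rewrite ler_norml => /andP[s1 s2].
have e1 := expR_ge1Dx s; have e2 := expR_ge1Dx (- s).
have e0 := expR_gt0 s.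
have eN : expR s * expR (- s) = 1 by rewrite -expRD subrr expR0.
have e3 : expR s * (1 - s) <= 1 by rewrite -[leRHS]eN ler_pM2l.
by rewrite ler_norml; case: (lerP 0 s) => s0;
  rewrite ?(ger0_norm s0) ?(ltr0_norm s0); apply/andP; split; nra.
Qed.

(** With v = exp(x^T beta / 2) the fitted probability is v^2 / (1 + v^2), its
    standard deviation is v / (1 + v^2), and the standardized residual is 1 / v
    for a response 1 and - v for a response 0. Bounds and increments of all
    these quantities thus reduce to those of v and 1 / v. *)
Definition root_odds m p (Xi : 'M[R]_(m, p)) (beta : 'cV[R]_p) (j : 'I_m) : R :=
  expR ((Xi *m beta) j 0 / 2).

Section Cluster.
Variables (m p : nat) (Xi : 'M[R]_(m, p)).
Implicit Types (beta : 'cV[R]_p) (j : 'I_m).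

Lemma root_odds_gt0 beta j : 0 < root_odds Xi beta j.
Proof. exact: expR_gt0. Qed.

Lemma pi_root_odds beta j :
  pi_ Xi beta j 0 = root_odds Xi beta j ^+ 2 / (1 + root_odds Xi beta j ^+ 2).
Proof.
by rewrite mxE /root_odds expr2 -expRD -splitr.
Qed.

Lemma A_ge0 beta j : 0 <= A_ Xi beta j.
Proof.
have v0 := root_odds_gt0 beta j.
rewrite /A_ pi_root_odds; set v := root_odds Xi beta j in v0 *.
have d0 : 0 < 1 + v ^+ 2 by rewrite ltr_wpDr ?sqr_ge0.
have -> : 1 - v ^+ 2 / (1 + v ^+ 2) = (1 + v ^+ 2)^-1.
  by field; rewrite gt_eqF.
by rewrite !mulr_ge0 ?invr_ge0 ?sqr_ge0 ?ltW.
Qed.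

Lemma sqrt_A_root_odds beta j : Num.sqrt (A_ Xi beta j) =
  root_odds Xi beta j / (1 + root_odds Xi beta j ^+ 2).
Proof.
have v0 := root_odds_gt0 beta j.
rewrite /A_ pi_root_odds; set v := root_odds Xi beta j in v0 *.
have d0 : 0 < 1 + v ^+ 2 by rewrite ltr_wpDr ?sqr_ge0.
have -> : v ^+ 2 / (1 + v ^+ 2) * (1 - v ^+ 2 / (1 + v ^+ 2)) =
    (v / (1 + v ^+ 2)) ^+ 2 by field; rewrite gt_eqF.
by rewrite sqrtr_sqr ger0_norm // divr_ge0 ?ltW.
Qed.

Lemma epsilon_root_odds yi beta j : epsilon_ Xi yi beta j 0 =
  yi j 0 * (root_odds Xi beta j + (root_odds Xi beta j)^-1) - root_odds Xi beta j.
Proof.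
have v0 := root_odds_gt0 beta j.
rewrite /epsilon_ /A_neghalf mul_diag_mx mxE [X in X * _]mxE sqrt_A_root_odds.
have mxB (x y : 'cV[R]_m) : (x - y) j 0 = x j 0 - y j 0 by rewrite !mxE.
rewrite mxB pi_root_odds.
set v := root_odds Xi beta j in v0 *.
have d0 : 0 < 1 + v ^+ 2 by rewrite ltr_wpDr ?sqr_ge0.
by field; rewrite !gt_eqF.
Qed.

(** v <= 1 + v^2 = 1 / (1 - pi) and 1 / v <= 1 + 1 / v^2 = 1 / pi. *)
Lemma root_odds_le b1 b2 beta j : 0 < b1 -> b2 < 1 ->
  b1 <= pi_ Xi beta j 0 <= b2 ->
  root_odds Xi beta j <= 1 + b1^-1 + (1 - b2)^-1 /\
  (root_odds Xi beta j)^-1 <= 1 + b1^-1 + (1 - b2)^-1.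
Proof.
move=> b10 b21; have v0 := root_odds_gt0 beta j; rewrite pi_root_odds.
set v := root_odds Xi beta j in v0 *.
have d0 : 0 < 1 + v ^+ 2 by rewrite ltr_wpDr ?sqr_ge0.
have b20 : 0 < 1 - b2 by rewrite subr_gt0.
rewrite ler_pdivlMr // ler_pdivrMr // => /andP[h1 h2].
have i1 : 0 < b1^-1 by rewrite invr_gt0.
have i2 : 0 < (1 - b2)^-1 by rewrite invr_gt0.
have e1 : 1 + v ^+ 2 <= (1 - b2)^-1 by rewrite -[_^-1]mul1r ler_pdivlMr //; nra.
have e2 : 1 + v ^- 2 <= b1^-1.
  rewrite -[b1^-1]mul1r ler_pdivlMr // -(ler_pM2r (exprn_gt0 2 v0)).
  have -> : (1 + v ^- 2) * b1 * v ^+ 2 = b1 * (1 + v ^+ 2).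
    by field; rewrite gt_eqF.
  by rewrite mul1r.
split; first by nra.
have vi0 : 0 < v^-1 by rewrite invr_gt0.
by rewrite -exprVn in e2; nra.
Qed.

Section Perturb.
Variables (V del : R) (beta0 beta : 'cV[R]_p) (j : 'I_m).
Hypotheses (V0 : root_odds Xi beta0 j <= V).
Hypotheses (V0' : (root_odds Xi beta0 j)^-1 <= V).
Hypotheses (del1 : del <= 1).
Hypothesis (hdel : `|(Xi *m (beta - beta0)) j 0| <= del).

(** A shift of the linear predictor by 2 s multiplies v by exp s. *)
Lemma root_odds_perturb :
  `|root_odds Xi beta j - root_odds Xi beta0 j| <= V * del /\
  `|(root_odds Xi beta j)^-1 - (root_odds Xi beta0 j)^-1| <= V * del.
Proof.
set s := (Xi *m (beta - beta0)) j 0 / 2.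
have sdel : 2 * `|s| <= del.
  by rewrite -(normr_nat R 2) -normrM /s mulrC divfK ?pnatr_eq0.
have s12 : `|s| <= 1 / 2 by rewrite ler_pdivlMr // mulrC; exact: le_trans del1.
have v0 := root_odds_gt0 beta0 j.
have vE : root_odds Xi beta j = root_odds Xi beta0 j * expR s.
  have mxB (x y : 'cV[R]_m) : (x - y) j 0 = x j 0 - y j 0 by rewrite !mxE.
  rewrite /root_odds -expRD /s mulmxBr mxB.
  by congr expR; field.
have del0 : 0 <= del := le_trans (normr_ge0 _) hdel.
have vi0 : 0 < (root_odds Xi beta0 j)^-1 by rewrite invr_gt0.
have factor (x y : R) : x * y - x = x * (y - 1) by ring.
split.
  rewrite vE factor normrM gtr0_norm // ler_pM ?(ltW v0) //.
  by apply: le_trans (expR_sub1_le s12) _.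
rewrite vE invfM -(expRN s) factor normrM gtr0_norm // ler_pM ?(ltW vi0) //.
by rewrite -normrN in s12 sdel; apply: le_trans (expR_sub1_le s12) _.
Qed.

(** The map v -> v / (1 + v^2) is 1-Lipschitz on positive numbers: its
    difference quotient is (1 - v w) / ((1 + v^2) (1 + w^2)). *)
Lemma sqrt_A_perturb :
  `|Num.sqrt (A_ Xi beta j) - Num.sqrt (A_ Xi beta0 j)| <= V * del.
Proof.
have [h _] := root_odds_perturb; apply: le_trans h.
rewrite !sqrt_A_root_odds.
have := root_odds_gt0 beta0 j; have := root_odds_gt0 beta j.
set w := root_odds Xi beta j; set v := root_odds Xi beta0 j => w0 v0.
have dv0 : 0 < 1 + v ^+ 2 by rewrite ltr_wpDr ?sqr_ge0.
have dw0 : 0 < 1 + w ^+ 2 by rewrite ltr_wpDr ?sqr_ge0.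
have -> : w / (1 + w ^+ 2) - v / (1 + v ^+ 2) =
    (w - v) * ((1 - v * w) / ((1 + v ^+ 2) * (1 + w ^+ 2))).
  by field; rewrite !gt_eqF.
rewrite normrM ler_piMr //.
rewrite normrM normfV (gtr0_norm (mulr_gt0 _ _)) // ler_pdivrMr ?mulr_gt0 //.
have vw0 := mulr_gt0 v0 w0.
by rewrite mul1r ler_norml; apply/andP; split; nra.
Qed.

Lemma epsilon_perturb (yi : 'cV[R]_m) : yi j 0 = 0 \/ yi j 0 = 1 ->
  `|epsilon_ Xi yi beta0 j 0| <= V /\
  `|epsilon_ Xi yi beta j 0 - epsilon_ Xi yi beta0 j 0| <= V * del.
Proof.
have [h1 h2] := root_odds_perturb.
have v0 := root_odds_gt0 beta0 j.
rewrite !epsilon_root_odds.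
have V1 := V0; have V1' := V0'.
set w := root_odds Xi beta j in h1 h2 *.
set v := root_odds Xi beta0 j in v0 V1 V1' h1 h2 *.
have vi0 : 0 < v^-1 by rewrite invr_gt0.
case=> ->.
  rewrite !mul0r !sub0r normrN gtr0_norm //; split => //.
  by rewrite -opprD normrN.
have e z : 1 * (z + z^-1) - z = z^-1 by rewrite mul1r addrC addKr.
by rewrite !e gtr0_norm.
Qed.
End Perturb.

Lemma sqrt_A_le1 beta j : `|Num.sqrt (A_ Xi beta j)| <= 1.
Proof.
rewrite sqrt_A_root_odds; have := root_odds_gt0 beta j.
set v := root_odds _ _ _ => v0.
have d0 : 0 < 1 + v ^+ 2 by rewrite ltr_wpDr ?sqr_ge0.
rewrite ger0_norm ?divr_ge0 ?(ltW v0) ?(ltW d0) // ler_pdivrMr // mul1r; nra.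
Qed.

End Cluster.

Lemma approximates_diag m K del (d' d : 'rV[R]_m) : 0 <= K -> 0 <= del ->
  (forall j, `|d 0 j| <= K) -> (forall j, `|d' 0 j - d 0 j| <= K * del) ->
  approximates del ((m * m)%:R * K) (diag_mx d') (diag_mx d).
Proof.
move=> K0 del0 dK ddK; apply: approximates_frobenius.
  apply: frobenius_norm_le_entry => // i j; rewrite mxE.
  by case: eqP => _; rewrite ?mulr1n ?mulr0n ?normr0.
rewrite -mulrA; apply: frobenius_norm_le_entry => [|i j]; first exact: mulr_ge0.
rewrite !mxE; case: eqP => _; rewrite ?mulr1n //.
by rewrite !mulr0n subrr normr0 mulr_ge0.
Qed.

Lemma approximates_col m K del (e' e : 'cV[R]_m) : 0 <= K -> 0 <= del ->
  (forall j, `|e j 0| <= K) -> (forall j, `|e' j 0 - e j 0| <= K * del) ->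
  approximates del (m%:R * K) e' e /\ approximates del (m%:R * K) e'^T e^T.
Proof.
move=> K0 del0 eK deK.
have h1 : frobenius_norm e <= m%:R * K.
  rewrite -[m in m%:R]muln1; apply: frobenius_norm_le_entry => // i j.
  by rewrite (ord1 j).
have h2 : frobenius_norm (e' - e) <= m%:R * K * del.
  rewrite -[m in m%:R]muln1 -mulrA; apply: frobenius_norm_le_entry => [|i j].
    exact: mulr_ge0.
  by rewrite (ord1 j) !mxE.
split; apply: approximates_frobenius => //; first by rewrite frobenius_norm_tr.
by rewrite -[X in frobenius_norm (_ - X)]/(e^T) -linearB /= frobenius_norm_tr.
Qed.

End Logistic.

(** * Stability of the sandwich matrix *)

Section Sandwich.
Variable R : realType.

Lemma H_sandwichE n m p (X : 'I_n -> 'M[R]_(m, p)) W beta :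
  H_ X W beta = \sum_i (X i)^T *m
    (A_half (X i) beta *m invmx W *m A_half (X i) beta) *m X i.
Proof. by apply: eq_bigr => i _; rewrite !mulmxA. Qed.

Lemma Mhat_sandwichE n m p (X : 'I_n -> 'M[R]_(m, p)) y W beta :
  Mhat X y W beta = \sum_i (X i)^T *m
    (A_half (X i) beta *m invmx W *m epsilon_ (X i) (y i) beta *m
     (epsilon_ (X i) (y i) beta)^T *m invmx W *m A_half (X i) beta) *m X i.
Proof. by apply: eq_bigr => i _; rewrite !mulmxA. Qed.

Lemma scale_sandwichB p (c : R) (N' N M' M : 'M[R]_p) : c != 0 ->
  c^-1 *: N' \in unitmx -> c^-1 *: N \in unitmx ->
  c *: (invmx N' *m M' *m invmx N' - invmx N *m M *m invmx N) =
  invmx (c^-1 *: N') *m (c^-1 *: M') *m invmx (c^-1 *: N') -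
  invmx (c^-1 *: N) *m (c^-1 *: M) *m invmx (c^-1 *: N).
Proof.
move=> c0 uN' uN; rewrite scalerBr !invmxZ // invrK.
by rewrite -!scalemxAl -!scalemxAr -!scalemxAl; rewrite !scalerA mulfV // mulr1.
Qed.

(** The quadratic form of the scaled Gram matrix at x is the mean of |X_i x|^2. *)
Lemma scaled_gram_bounds n m p (X : 'I_n -> 'M[R]_(m, p)) b3 b4
    (XX := n%:R^-1 *: \sum_(i < n) (X i)^T *m X i) :
  b3 <= lambda_min XX -> lambda_max XX <= b4 -> forall x : 'cV[R]_p,
  b3 * frobenius_norm x ^+ 2 <=
    n%:R^-1 * \sum_i frobenius_norm (X i *m x) ^+ 2 <=
    b4 * frobenius_norm x ^+ 2.
Proof.
move=> h3 h4 x.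
have symXX : XX^T = XX.
  rewrite /XX linearZ /= linear_sum /=; congr (_ *: _).
  by apply: eq_bigr => i _; rewrite trmx_mul trmxK.
have <- : quadratic_form XX x =
    n%:R^-1 * \sum_i frobenius_norm (X i *m x) ^+ 2.
  rewrite quadratic_formZ; congr (_ * _).
  rewrite /quadratic_form mulmx_sumr mulmx_suml summxE.
  apply: eq_bigr => i _; rewrite sqr_frobenius_norm_dot trmx_mul.
  by rewrite !mulmxA.
by rewrite lambda_min_quadratic // lambda_max_quadratic.
Qed.

Section Moderate.
Variables (m : nat) (b1 b2 : R) (hb1 : 0 < b1) (hb2 : b2 < 1).

Let V := 1 + b1^-1 + (1 - b2)^-1.

Let V1 : 1 <= V.
Proof.
by rewrite /V -addrA lerDl addr_ge0 // invr_ge0 ltW // subr_gt0.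
Qed.

Let V0 : 0 <= V. Proof. exact: le_trans V1. Qed.

Lemma A_half_approximates del p (Xi : 'M[R]_(m, p)) beta0 beta :
  0 <= del -> del <= 1 ->
  (forall j, b1 <= pi_ Xi beta0 j 0 <= b2) ->
  (forall j, `|(Xi *m (beta - beta0)) j 0| <= del) ->
  approximates del ((m * m)%:R * V) (A_half Xi beta) (A_half Xi beta0).
Proof.
move=> del0 del1 pib hdel; apply: approximates_diag => // j; rewrite !mxE.
  by apply: le_trans V1; exact: sqrt_A_le1.
have [h1 h2] := root_odds_le hb1 hb2 (pib j).
exact: sqrt_A_perturb.
Qed.

Lemma epsilon_approximates del p (Xi : 'M[R]_(m, p)) (yi : 'cV[R]_m)
    beta0 beta :
  0 <= del -> del <= 1 ->
  (forall j, yi j 0 = 0 \/ yi j 0 = 1) ->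
  (forall j, b1 <= pi_ Xi beta0 j 0 <= b2) ->
  (forall j, `|(Xi *m (beta - beta0)) j 0| <= del) ->
  approximates del (m%:R * V) (epsilon_ Xi yi beta) (epsilon_ Xi yi beta0) /\
  approximates del (m%:R * V) (epsilon_ Xi yi beta)^T (epsilon_ Xi yi beta0)^T.
Proof.
move=> del0 del1 y01 pib hdel; apply: approximates_col => // j;
  have [h1 h2] := root_odds_le hb1 hb2 (pib j);
  by have [] := epsilon_perturb h1 h2 del1 (hdel j) (y01 j).
Qed.

Lemma A_half_coercive p (Xi : 'M[R]_(m, p)) beta0 (z : 'cV[R]_m) :
  (forall j, b1 <= pi_ Xi beta0 j 0 <= b2) ->
  b1 * (1 - b2) * frobenius_norm z ^+ 2 <=
    frobenius_norm (A_half Xi beta0 *m z) ^+ 2.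
Proof.
move=> pib; rewrite !sqr_frobenius_norm_col mulr_sumr; apply: ler_sum => j _.
rewrite /A_half mul_diag_mx mxE [X in (X * _) ^+ 2]mxE exprMn sqr_sqrtr ?A_ge0 //.
rewrite ler_wpM2r ?sqr_ge0 //; have /andP[h1 h2] := pib j.
apply: ler_pM => //; first exact: ltW.
  by rewrite subr_ge0 ltW.
by rewrite lerB.
Qed.

(** Coercivity is lost by explicit factors only: 1 / (|Rbar| + 1) for the
    inverse of Rbar, b1 (1 - b2) for the variances, b3 for the Gram matrix. *)
Lemma H_coercive n p (X : 'I_n -> 'M[R]_(m, p)) beta0 Rbar b3 x :
  (0 < n)%N -> 0 <= b3 -> positive_definite Rbar ->
  (forall i j, b1 <= pi_ (X i) beta0 j 0 <= b2) ->
  b3 * frobenius_norm x ^+ 2 <=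
    n%:R^-1 * \sum_i frobenius_norm (X i *m x) ^+ 2 ->
  (frobenius_norm Rbar + 1)^-1 * (b1 * (1 - b2)) * b3 * frobenius_norm x ^+ 2
    <= quadratic_form (n%:R^-1 *: H_ X Rbar beta0) x.
Proof.
move=> n0 b30 [symR posR] pib Xx.
have uR : Rbar \in unitmx.
  rewrite unitmxE unitfE; apply/det0P => -[v v0 vR].
  have vT0 : v^T != 0.
    by apply: contra_neq v0 => /(congr1 trmx); rewrite trmxK trmx0.
  by have := posR v^T vT0; rewrite trmxK vR mul0mx mxE ltxx.
set r := (frobenius_norm Rbar + 1)^-1.
have r10 : 0 < frobenius_norm Rbar + 1 by rewrite ltr_wpDl ?frobenius_norm_ge0.
have r0 : 0 < r by rewrite invr_gt0.
have psdR z : 0 <= quadratic_form (invmx Rbar) z.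
  have [->|z0] := eqVneq z 0; first by rewrite /quadratic_form mulmx0 mxE.
  have -> : quadratic_form (invmx Rbar) z =
      ((invmx Rbar *m z)^T *m Rbar *m (invmx Rbar *m z)) 0 0.
    rewrite trmx_mul trmx_inv symR /quadratic_form; congr (_ _ 0 0).
    by rewrite !mulmxA mulmxKV.
  apply: ltW; apply: posR; apply: contra_neq z0 => /(congr1 (mulmx Rbar)).
  by rewrite mulmxA mulmxV // mul1mx mulmx0.
have symRi : (invmx Rbar)^T = invmx Rbar by rewrite trmx_inv symR.
have coerR z : r * frobenius_norm z ^+ 2 <= quadratic_form (invmx Rbar) z.
  rewrite ler_pdivrMl // ; have := psd_invertible_coercive z symRi psdR.
  rewrite unitmx_inv invmxK => /(_ uR) h; apply: le_trans h _.
  by rewrite ler_wpM2r // lerDl.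
have -> : quadratic_form (n%:R^-1 *: H_ X Rbar beta0) x = n%:R^-1 *
    \sum_i quadratic_form (invmx Rbar) (A_half (X i) beta0 *m (X i *m x)).
  rewrite quadratic_formZ; congr (_ * _).
  rewrite /quadratic_form H_sandwichE mulmx_sumr mulmx_suml summxE.
  by apply: eq_bigr => i _; rewrite !trmx_mul tr_diag_mx !mulmxA.
have c0 : 0 <= r * (b1 * (1 - b2)).
  by rewrite !mulr_ge0 ?ltW // subr_gt0.
rewrite -mulrA; apply: le_trans (ler_wpM2l c0 Xx) _.
rewrite mulrCA ler_wpM2l ?invr_ge0 // mulr_sumr.
apply: ler_sum => i _; apply: le_trans (coerR _).
rewrite -mulrA ler_wpM2l ?(ltW r0) //; exact: A_half_coercive.
Qed.

(** The constant K depends on m, Rbar and the bounds b1, ..., b4, neither on n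
    and p nor on the data. It is the one that the calculus of [approximates] yields for the
    product (H/n)^-1 (M/n) (H/n)^-1, enlarged so that K del <= 1 forces both del
    <= 1, needed to multiply estimates, and kH del <= r / 2, needed to invert
    H/n. *)
Lemma sandwich_perturbation (b3 b4 : R) (Rbar : 'M[R]_m) :
  0 < b3 -> 0 < b4 -> positive_definite Rbar ->
  exists2 K : R, 0 < K & forall n p (X : 'I_n -> 'M[R]_(m, p))
    (y : 'I_n -> 'cV[R]_m) (Rhat R0 : 'M[R]_m)
    (beta0 beta : 'cV[R]_p) del, (0 < n)%N ->
  (forall i j, y i j 0 = 0 \/ y i j 0 = 1) ->
  (forall i j, b1 <= pi_ (X i) beta0 j 0 <= b2) ->
  (forall x : 'cV[R]_p, b3 * frobenius_norm x ^+ 2 <=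
     n%:R^-1 * \sum_i frobenius_norm (X i *m x) ^+ 2 <=
     b4 * frobenius_norm x ^+ 2) ->
  0 <= del -> K * del <= 1 ->
  frobenius_norm (invmx Rhat - invmx Rbar) <= del ->
  (forall i j, `|(X i *m (beta - beta0)) j 0| <= del) ->
  frobenius_norm (n%:R^-1 *: (Mhat X y Rbar beta0 - Mbar X Rbar R0 beta0))
    <= del ->
  operator_bound (n%:R *: (Sigmahat X y Rhat beta - Sigma X Rbar R0 beta0))
    (K * del).
Proof.
move=> hb3 hb4 Rpos.
pose ka := (m * m)%:R * V; pose ke := m%:R * V.
pose kw := frobenius_norm (invmx Rbar) + 1.
pose kH := b4 * (3 * (3 * ka * kw) * ka).
pose kM := b4 * (3 * (3 * (3 * (3 * (3 * ka * kw) * ke) * ke) * kw) * ka) + 1.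
pose r := (frobenius_norm Rbar + 1)^-1 * (b1 * (1 - b2)) * b3.
pose kI := r^-1 + 2 * kH / r ^+ 2.
pose kS := 3 * (3 * kI * kM) * kI.
have ka0 : 0 <= ka by rewrite mulr_ge0.
have ke0 : 0 <= ke by rewrite mulr_ge0.
have kw0 : 0 <= kw by rewrite addr_ge0 ?frobenius_norm_ge0.
have kH0 : 0 <= kH by rewrite !mulr_ge0 // ltW.
have kM0 : 0 <= kM by rewrite addr_ge0 // !mulr_ge0 // ltW.
have r0 : 0 < r.
  rewrite !mulr_gt0 ?subr_gt0 // invr_gt0 ltr_wpDl ?frobenius_norm_ge0 //.
have kI0 : 0 <= kI.
  by rewrite addr_ge0 ?divr_ge0 ?invr_ge0 ?sqr_ge0 ?(ltW r0) // mulr_ge0.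
have kS0 : 0 <= kS by rewrite !mulr_ge0.
have kHr0 : 0 <= 2 * kH / r by rewrite divr_ge0 ?(ltW r0) // mulr_ge0.
exists (1 + 2 * kH / r + kS); first by rewrite -addrA ltr_wpDr // addr_ge0.
move=> n p X y Rhat R0 beta0 beta del n0 y01 pib XX del0 Kdel Rdel bdel Ddel.
have [kd1 kd2] : del <= 1 /\ 2 * kH / r * del <= 1.
  have h1 : 0 <= 2 * kH / r * del by exact: mulr_ge0.
  have h2 : 0 <= kS * del by exact: mulr_ge0.
  by move: Kdel; rewrite !mulrDl mul1r; split; lra.
have b40 := ltW hb4.
have Xb (x : 'cV[R]_p) : n%:R^-1 * \sum_i frobenius_norm (X i *m x) ^+ 2
     <= b4 * frobenius_norm x ^+ 2 by case/andP: (XX x).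
have aA i := A_half_approximates del0 kd1 (pib i) (bdel i).
have aE i := epsilon_approximates del0 kd1 (y01 i) (pib i) (bdel i).
have aW : approximates del kw (invmx Rhat) (invmx Rbar).
  apply: approximates_frobenius; first by rewrite lerDl.
  apply: le_trans Rdel _; rewrite ler_peMl // lerDr; exact: frobenius_norm_ge0.
have aH : approximates del kH (n%:R^-1 *: H_ X Rhat beta)
    (n%:R^-1 *: H_ X Rbar beta0).
  rewrite !H_sandwichE; apply: approximates_cluster_sum => // [|i].
    by rewrite !mulr_ge0.
  by do 2!apply: approximatesM => //.
have aM : approximates del kM (n%:R^-1 *: Mhat X y Rhat beta)
    (n%:R^-1 *: Mbar X Rbar R0 beta0).
  (* First move the parameters at fixed responses, then replace the products of
     residuals by their means: the last step costs the noise. *)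
  apply: (@approximates_shift _ _ _ _ _ _ _
    (n%:R^-1 *: Mhat X y Rbar beta0)) => //.
    rewrite !Mhat_sandwichE; apply: approximates_cluster_sum => // [|i].
      by rewrite !mulr_ge0.
    by have [e1 e2] := aE i; do 5!apply: approximatesM => //.
  by rewrite -scalerBr; exact: operator_bound_frobenius.
have Hr (x : 'cV[R]_p) :=
  H_coercive n0 (ltW hb3) Rpos pib (proj1 (andP (XX x))).
have kHr : kH * del <= r / 2.
  have : 2 * kH / r * del * r <= 1 * r by rewrite ler_pM2r.
  have -> : 2 * kH / r * del * r = 2 * (kH * del) by field; rewrite gt_eqF.
  by rewrite ler_pdivlMr //; lra.
have aI := approximates_invmx del0 r0 Hr aH kHr.
have nR : n%:R != 0 :> R by rewrite pnatr_eq0 -lt0n.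
have uH := coercive_unitmx r0 Hr.
have uH' := coercive_unitmx (divr_gt0 r0 (ltr0n R 2))
  (fun x => approximates_coercive x aH kHr Hr).
have aS := approximatesM del0 kd1 (approximatesM del0 kd1 aI aM) aI.
have -> : n%:R *: (Sigmahat X y Rhat beta - Sigma X Rbar R0 beta0) = _ :=
  scale_sandwichB _ _ nR uH' uH.
have kSK : kS <= 1 + 2 * kH / r + kS by rewrite lerDr; exact: addr_ge0.
have [_ _ bS] := aS.
exact: operator_bound_le (ler_wpM2r del0 kSK) bS.
Qed.

End Moderate.
End Sandwich.

(** * Means and correlations of bounded random variables *)

Section BoundedVariables.
Variables (R : realType) (d : measure_display) (T : measurableType d).
Variable P : probability T R.
Implicit Types f g h : T -> R.

Definition bounded_rv f : Prop :=
  measurable_fun [set: T] f /\ exists K : R, forall w, `|f w| <= K.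

Definition mean f : R := Rintegral P setT f.

(** Factorization of the mean of a product; unlike independence it is preserved
    by linear combinations, and it is all that the variance of a sum requires. *)
Definition uncorrelated f g : Prop :=
  mean (fun w => f w * g w) = mean f * mean g.

Lemma bounded_rv_integrable f : bounded_rv f ->
  P.-integrable [set: T] (EFin \o f).
Proof.
move=> [mf [K fK]]; apply: measurable_bounded_integrable => //.
  by apply: (le_lt_trans (probability_le1 P measurableT)); rewrite ltry.
exists K; split; first exact: num_real.
by move=> x Kx w _ /=; apply: le_trans (ltW Kx).
Qed.

Lemma bounded_rv_cst c : bounded_rv (fun _ => c).
Proof. by split; [exact: measurable_cst|exists `|c|]. Qed.

Lemma bounded_rvD f g : bounded_rv f -> bounded_rv g ->
  bounded_rv (fun w => f w + g w).
Proof.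
move=> [mf [K fK]] [mg [L gL]]; split; first exact: measurable_funD.
by exists (K + L) => w; apply: le_trans (ler_normD _ _) _; exact: lerD.
Qed.

Lemma bounded_rvM f g : bounded_rv f -> bounded_rv g ->
  bounded_rv (fun w => f w * g w).
Proof.
move=> [mf [K fK]] [mg [L gL]]; split; first exact: measurable_funM.
by exists (K * L) => w; rewrite normrM ler_pM.
Qed.

Lemma bounded_rvZ c f : bounded_rv f -> bounded_rv (fun w => c * f w).
Proof. by apply: bounded_rvM; exact: bounded_rv_cst. Qed.

Lemma bounded_rv_sum (I : finType) (F : I -> T -> R) :
  (forall i, bounded_rv (F i)) -> bounded_rv (fun w => \sum_i F i w).
Proof.
move=> bF; elim: (index_enum I) => [|i s IH].
  by under eq_fun do rewrite big_nil; exact: bounded_rv_cst.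
by under eq_fun do rewrite big_cons; exact: bounded_rvD.
Qed.

Lemma meanD f g : bounded_rv f -> bounded_rv g ->
  mean (fun w => f w + g w) = mean f + mean g.
Proof. by move=> bf bg; apply: RintegralD => //; exact: bounded_rv_integrable. Qed.

Lemma meanZ c f : bounded_rv f -> mean (fun w => c * f w) = c * mean f.
Proof. by move=> bf; apply: RintegralZl => //; exact: bounded_rv_integrable. Qed.

Lemma mean_cst c : mean (fun _ => c) = c.
Proof.
rewrite /mean Rintegral_cst // -[RHS]mulr1; congr (_ * _).
by rewrite -[RHS]/(fine 1%:E); congr fine; exact: probability_setT.
Qed.

Lemma mean_le f g : bounded_rv f -> bounded_rv g -> (forall w, f w <= g w) ->
  mean f <= mean g.
Proof.
by move=> bf bg fg; apply: le_Rintegral => //; exact: bounded_rv_integrable.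
Qed.

Lemma mean_norm_le f K : bounded_rv f -> (forall w, `|f w| <= K) ->
  `|mean f| <= K.
Proof.
move=> bf fK; rewrite ler_norml; apply/andP; split.
  rewrite -[X in X <= _]mean_cst; apply: mean_le => // [|w].
    exact: bounded_rv_cst.
  by have := fK w; rewrite ler_norml => /andP[].
rewrite -[X in _ <= X]mean_cst; apply: mean_le => // [|w].
  exact: bounded_rv_cst.
by have := fK w; rewrite ler_norml => /andP[].
Qed.

Lemma mean_sum (I : finType) (F : I -> T -> R) : (forall i, bounded_rv (F i)) ->
  mean (fun w => \sum_i F i w) = \sum_i mean (F i).
Proof.
move=> bF; elim: (index_enum I) => [|i s IH].
  by under eq_fun do rewrite big_nil; rewrite big_nil mean_cst.
under eq_fun do rewrite big_cons; rewrite big_cons meanD ?IH //.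
split; first by apply: measurable_sum => j; case: (bF j).
elim: s {IH} => [|j s [K sK]].
  by exists 0 => w; rewrite big_nil normr0.
have [_ [L jL]] := bF j; exists (L + K) => w; rewrite big_cons.
by apply: le_trans (ler_normD _ _) _; exact: lerD.
Qed.

Lemma mean_indicator (A : set T) : measurable A ->
  mean (\1_A : T -> R) = fine (P A).
Proof.
by move=> mA; rewrite /mean /Rintegral integral_indic // setIT.
Qed.

Lemma bounded_rv_indicator (A : set T) : measurable A ->
  bounded_rv (\1_A : T -> R).
Proof.
move=> mA; split; first exact: measurable_indic.
by exists 1 => w; rewrite indicE; case: (_ \in _); rewrite ?normr1 ?normr0.
Qed.

Lemma measurable_gt f (c : R) : measurable_fun [set: T] f ->
  measurable [set w | c < f w].
Proof.
move=> mf; rewrite -[X in measurable X]setTI.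
have -> : [set: T] `&` [set w | c < f w] = [set: T] `&` f @^-1` `]c, +oo[.
  by apply/seteqP; split=> w /= [_]; rewrite in_itv /= andbT.
by apply: mf => //; exact: measurable_itv.
Qed.

Lemma markov_bounded f (e : R) : bounded_rv f -> (forall w, 0 <= f w) -> 0 < e ->
  (P [set w | (e < f w)%R] <= (e^-1 * mean f)%:E)%E.
Proof.
move=> bf f0 e0; set A := [set w | e < f w].
have mA : measurable A by apply: measurable_gt; case: bf.
have fA : P A \is a fin_num by exact: fin_num_measure.
rewrite -(fineK fA) lee_fin ler_pdivlMl // -mean_indicator // -meanZ; last first.
  exact: bounded_rv_indicator.
apply: mean_le => // [|w].
  by apply: bounded_rvZ; exact: bounded_rv_indicator.
rewrite indicE; have [wA|_] := boolP (w \in A); last by rewrite mulr0.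
by rewrite mulr1; move: wA; rewrite inE => /ltW.
Qed.

Lemma uncorrelated_sym f g : uncorrelated f g -> uncorrelated g f.
Proof.
rewrite /uncorrelated mulrC => <-; congr mean; apply/funext => w.
by rewrite mulrC.
Qed.

Lemma uncorrelated_cst c g : bounded_rv g -> uncorrelated (fun _ => c) g.
Proof. by move=> bg; rewrite /uncorrelated meanZ // mean_cst. Qed.

Lemma uncorrelatedZ c f g : bounded_rv f -> bounded_rv g ->
  uncorrelated f g -> uncorrelated (fun w => c * f w) g.
Proof.
rewrite /uncorrelated => bf bg fg; rewrite (meanZ c bf) -mulrA -fg -meanZ.
  by congr mean; apply/funext => w; rewrite mulrA.
exact: bounded_rvM.
Qed.

Lemma uncorrelatedD f g h : bounded_rv f -> bounded_rv g -> bounded_rv h ->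
  uncorrelated f h -> uncorrelated g h ->
  uncorrelated (fun w => f w + g w) h.
Proof.
rewrite /uncorrelated => bf bg bh fh gh.
rewrite (meanD bf bg) mulrDl -fh -gh -meanD; last 2 first.
- exact: bounded_rvM.
- exact: bounded_rvM.
by congr mean; apply/funext => w; rewrite mulrDl.
Qed.

Lemma uncorrelated_sum (I : finType) (F : I -> T -> R) g :
  (forall i, bounded_rv (F i)) -> bounded_rv g ->
  (forall i, uncorrelated (F i) g) -> uncorrelated (fun w => \sum_i F i w) g.
Proof.
move=> bF bg Fg; rewrite /uncorrelated mean_sum // mulr_suml.
under eq_bigr do rewrite -Fg; rewrite -mean_sum => [|i]; last exact: bounded_rvM.
by congr mean; apply/funext => w; rewrite mulr_suml.
Qed.

(** Expanding the square, the cross terms vanish. *)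
Lemma mean_sqr_sum_uncorrelated (I : finType) (F : I -> T -> R) :
  (forall i, bounded_rv (F i)) -> (forall i, mean (F i) = 0) ->
  (forall i j, i != j -> uncorrelated (F i) (F j)) ->
  mean (fun w => (\sum_i F i w) ^+ 2) = \sum_i mean (fun w => F i w ^+ 2).
Proof.
move=> bF F0 Funcorr.
have -> : mean (fun w => (\sum_i F i w) ^+ 2) =
    mean (fun w => \sum_i \sum_j F i w * F j w).
  congr mean; apply/funext => w; rewrite expr2 mulr_suml.
  by apply: eq_bigr => i _; rewrite mulr_sumr.
have bFF i j : bounded_rv (fun w => F i w * F j w) by exact: bounded_rvM.
rewrite mean_sum => [|i]; last exact: bounded_rv_sum.
apply: eq_bigr => i _; rewrite mean_sum // (bigD1 i) //= big1 ?addr0.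
  by congr mean; apply/funext => w; rewrite expr2.
by move=> j ji; rewrite Funcorr 1?eq_sym // F0 mul0r.
Qed.

Lemma bounded_rv_mulmxl a b c (U : 'M[R]_(a, b)) (M : T -> 'M[R]_(b, c)) :
  (forall i j, bounded_rv (fun w => M w i j)) ->
  forall i j, bounded_rv (fun w => (U *m M w) i j).
Proof.
move=> bM i j; under eq_fun do rewrite mxE.
by apply: bounded_rv_sum => k; exact: bounded_rvZ.
Qed.

Lemma bounded_rv_mulmxr a b c (U : 'M[R]_(b, c)) (M : T -> 'M[R]_(a, b)) :
  (forall i j, bounded_rv (fun w => M w i j)) ->
  forall i j, bounded_rv (fun w => (M w *m U) i j).
Proof.
move=> bM i j; under eq_fun do rewrite mxE.
by apply: bounded_rv_sum => k; apply: bounded_rvM => //; exact: bounded_rv_cst.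
Qed.

Lemma mean_mulmxl a b c (U : 'M[R]_(a, b)) (M : T -> 'M[R]_(b, c)) :
  (forall i j, bounded_rv (fun w => M w i j)) ->
  (forall i j, mean (fun w => M w i j) = 0) ->
  forall i j, mean (fun w => (U *m M w) i j) = 0.
Proof.
move=> bM M0 i j; under eq_fun do rewrite mxE.
rewrite mean_sum => [|k]; last exact: bounded_rvZ.
by apply: big1 => k _; rewrite meanZ // M0 mulr0.
Qed.

Lemma mean_mulmxr a b c (U : 'M[R]_(b, c)) (M : T -> 'M[R]_(a, b)) :
  (forall i j, bounded_rv (fun w => M w i j)) ->
  (forall i j, mean (fun w => M w i j) = 0) ->
  forall i j, mean (fun w => (M w *m U) i j) = 0.
Proof.
move=> bM M0 i j; under eq_fun do (rewrite mxE; under eq_bigr do rewrite mulrC).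
rewrite mean_sum => [|k]; last exact: bounded_rvZ.
by apply: big1 => k _; rewrite meanZ // M0 mulr0.
Qed.

Lemma uncorrelated_mulmxl a b c (U : 'M[R]_(a, b)) (M : T -> 'M[R]_(b, c)) g :
  (forall i j, bounded_rv (fun w => M w i j)) -> bounded_rv g ->
  (forall i j, uncorrelated (fun w => M w i j) g) ->
  forall i j, uncorrelated (fun w => (U *m M w) i j) g.
Proof.
move=> bM bg Mg i j; under eq_fun do rewrite mxE.
by apply: uncorrelated_sum => // k; [exact: bounded_rvZ|exact: uncorrelatedZ].
Qed.

Lemma uncorrelated_mulmxr a b c (U : 'M[R]_(b, c)) (M : T -> 'M[R]_(a, b)) g :
  (forall i j, bounded_rv (fun w => M w i j)) -> bounded_rv g ->
  (forall i j, uncorrelated (fun w => M w i j) g) ->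
  forall i j, uncorrelated (fun w => (M w *m U) i j) g.
Proof.
move=> bM bg Mg i j; under eq_fun do (rewrite mxE; under eq_bigr do rewrite mulrC).
by apply: uncorrelated_sum => // k; [exact: bounded_rvZ|exact: uncorrelatedZ].
Qed.

End BoundedVariables.

(** * The noise of the middle matrix *)

Section ClusterNoise.
Variables (R : realType) (d : measure_display) (T : measurableType d).
Variable P : probability T R.
Variables (n m : nat) (Y : 'I_n -> 'I_m -> {RV P >-> R}).
Hypothesis Y01 : forall i j w, Y i j w = 0 \/ Y i j w = 1.

Lemma bounded_rv_response i j : bounded_rv (Y i j : T -> R).
Proof.
split; first exact: measurable_funPT.
by exists 1 => w; case: (Y01 i j w) => ->; rewrite ?normr0 ?normr1.
Qed.

Lemma bounded_rv_response2 i j k : bounded_rv (fun w => Y i j w * Y i k w).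
Proof. by apply: bounded_rvM; exact: bounded_rv_response. Qed.

Hypothesis Yindep : mutually_independent P
  (fun (i : 'I_n) (w : T) => [tuple Y i j w | j < m]).

(** A product of two binary responses of a cluster is the indicator of an event
    of that cluster, and events of two distinct clusters are independent. *)
Lemma response_products_uncorrelated i i' j k j' k' : i != i' ->
  uncorrelated P (fun w => Y i j w * Y i k w) (fun w => Y i' j' w * Y i' k' w).
Proof.
move=> ii'.
pose both (j k : 'I_m) : set (m.-tuple R) :=
  [set t | tnth t j = 1] `&` [set t | tnth t k = 1].
have mboth a b : measurable (both a b).
  apply: measurableI.
    by have := measurable_tnth a measurableT (measurable_set1 (1 : R));
      rewrite setTI.
  by have := measurable_tnth b measurableT (measurable_set1 (1 : R));
    rewrite setTI.
pose Z (i : 'I_n) (w : T) := [tuple Y i j w | j < m].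
have ZE i0 a b : Z i0 @^-1` both a b = [set w | Y i0 a w = 1 /\ Y i0 b w = 1].
  by apply/seteqP; split=> w; rewrite /both /Z /= !tnth_mktuple.
have mY i0 a : measurable [set w | Y i0 a w = 1].
  have := measurable_funPT (Y i0 a) measurableT _ (measurable_set1 (1 : R)).
  by rewrite setTI.
have mZ i0 a b : measurable (Z i0 @^-1` both a b).
  by rewrite ZE; exact: (measurableI _ _ (mY i0 a) (mY i0 b)).
have indicatorE i0 a b :
    (fun w => Y i0 a w * Y i0 b w) = \1_(Z i0 @^-1` both a b).
  apply/funext => w; rewrite ZE indicE.
  have [|/negP wA] := boolP (w \in _).
    by rewrite inE /= => -[-> ->]; rewrite mulr1.
  case: (Y01 i0 a w) => Ya; rewrite Ya ?mul0r //.
  case: (Y01 i0 b w) => Yb; rewrite Yb ?mulr0 //.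
  by case: wA; rewrite inE.
rewrite !indicatorE /uncorrelated.
have -> : (fun w => \1_(Z i @^-1` both j k) w * \1_(Z i' @^-1` both j' k') w) =
    \1_(Z i @^-1` both j k `&` Z i' @^-1` both j' k') :> (T -> R).
  by rewrite indicI.
rewrite !mean_indicator //; last exact: measurableI.
pose B x := if x == i then both j k else both j' k'.
have := Yindep [set i; i']%SET (B := B).
have -> : \bigcap_(x in [set` [set i; i']%SET]) (Z x @^-1` B x) =
    Z i @^-1` both j k `&` Z i' @^-1` both j' k'.
  apply/seteqP; split=> w.
    move=> h; split.
      by have := h i; rewrite /B eqxx; apply; rewrite /= !inE eqxx.
    by have := h i'; rewrite /B eq_sym (negbTE ii'); apply; rewrite /= !inE eqxx orbT.
  move=> [h1 h2] x /=; rewrite !inE => /orP[/eqP ->|/eqP ->]; rewrite /B ?eqxx //.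
  by rewrite eq_sym (negbTE ii').
rewrite big_setU1 ?inE //= big_set1 /B eqxx eq_sym (negbTE ii') => -> //.
  by rewrite fineM //; apply: fin_num_measure; exact: mZ.
by move=> x; case: ifP.
Qed.

Lemma mean_expectation (f : T -> R) : fine 'E_P[f]%E = mean P f.
Proof. by rewrite unlock. Qed.

Lemma fine_covariance (U V : T -> R) u v : mean P U = u -> mean P V = v ->
  fine (covariance P U V) = mean P (fun w => (U w - u) * (V w - v)).
Proof. by move=> <- <-; rewrite unlock !mean_expectation. Qed.

Variables (p : nat) (X : 'I_n -> 'M[R]_(m, p)) (beta0 : 'cV[R]_p).
Hypothesis EY : forall i j,
  ('E_P[Y i j] = (pi_ (X i) beta0 j 0)%:E)%E.
Variable R0 : 'M[R]_m.
Hypothesis corY : forall i j k, R0 j k = correlation P (Y i j) (Y i k).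

Let y w i : 'cV[R]_m := \col_j Y i j w.
Let eps w i := epsilon_ (X i) (y w i) beta0.
Let product_error w i := eps w i *m (eps w i)^T - R0.

Lemma epsilonE w i j : eps w i j 0 =
  (Num.sqrt (A_ (X i) beta0 j))^-1 * (Y i j w - pi_ (X i) beta0 j 0).
Proof.
rewrite /eps /epsilon_ /A_neghalf mul_diag_mx mxE [X in X * _]mxE.
have mxB (u v : 'cV[R]_m) : (u - v) j 0 = u j 0 - v j 0 by rewrite !mxE.
by rewrite mxB [y w i j 0]mxE.
Qed.

Lemma mean_response i j : mean P (Y i j) = pi_ (X i) beta0 j 0.
Proof. by rewrite -mean_expectation EY. Qed.

Lemma product_errorE w i j k :
  product_error w i j k = eps w i j 0 * eps w i k 0 - R0 j k.
Proof.
have mxB (U V : 'M[R]_m) : (U - V) j k = U j k - V j k by rewrite !mxE.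
by rewrite mxB mxE big_ord1 [in X in _ * X]mxE.
Qed.

Lemma bounded_rv_epsilon i j : bounded_rv (fun w => eps w i j 0).
Proof.
under eq_fun do rewrite epsilonE.
apply: bounded_rvZ; apply: bounded_rvD; first exact: bounded_rv_response.
exact: bounded_rv_cst.
Qed.

Lemma bounded_rv_product_error i j k :
  bounded_rv (fun w => product_error w i j k).
Proof.
under eq_fun do rewrite product_errorE.
apply: bounded_rvD; last exact: bounded_rv_cst.
by apply: bounded_rvM; exact: bounded_rv_epsilon.
Qed.

Lemma fine_variance_response i j : fine 'V_P[Y i j] = A_ (X i) beta0 j.
Proof.
have m0 := mean_response i j; rewrite (fine_covariance m0 m0) /A_.
set q := pi_ (X i) beta0 j 0 in m0 *.
have -> : (fun w => (Y i j w - q) * (Y i j w - q)) =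
    (fun w => (1 - 2 * q) * Y i j w + q ^+ 2).
  by apply/funext => w; case: (Y01 i j w) => ->; ring.
have bY := bounded_rv_response i j.
rewrite meanD; [|exact: bounded_rvZ|exact: bounded_rv_cst].
by rewrite meanZ // mean_cst m0; ring.
Qed.

(** Since a binary response with mean pi has variance pi (1 - pi), standardized
    residuals are the responses centred and divided by their true standard
    deviations, and the mean of their products is the correlation. *)
Lemma mean_epsilon_product i j k :
  mean P (fun w => eps w i j 0 * eps w i k 0) = R0 j k.
Proof.
rewrite (corY i) /correlation !fine_variance_response.
rewrite (fine_covariance (mean_response i j) (mean_response i k)).
rewrite invfM mulrC -meanZ; last first.
  by apply: bounded_rvM; apply: bounded_rvD;
    do ?[exact: bounded_rv_response|exact: bounded_rv_cst].
by congr mean; apply/funext => w; rewrite !epsilonE mulrACA.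
Qed.

Lemma mean_product_error i j k : mean P (fun w => product_error w i j k) = 0.
Proof.
under eq_fun do rewrite product_errorE.
rewrite meanD ?mean_cst ?mean_epsilon_product ?subrr //.
  by apply: bounded_rvM; exact: bounded_rv_epsilon.
exact: bounded_rv_cst.
Qed.

(** As Y^2 = Y for binary responses, the error is an affine combination of
    products of two responses of the cluster. *)
Lemma uncorrelated_product_error i (g : T -> R) : bounded_rv g ->
  (forall j k, uncorrelated P (fun w => Y i j w * Y i k w) g) ->
  forall j k, uncorrelated P (fun w => product_error w i j k) g.
Proof.
move=> bg Yg j k.
set sj := (Num.sqrt (A_ (X i) beta0 j))^-1.
set sk := (Num.sqrt (A_ (X i) beta0 k))^-1.
set qj := pi_ (X i) beta0 j 0; set qk := pi_ (X i) beta0 k 0.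
have -> : (fun w => product_error w i j k) = (fun w =>
    sj * sk * (Y i j w * Y i k w) + (- (sj * sk * qk) * (Y i j w * Y i j w) +
    (- (sj * sk * qj) * (Y i k w * Y i k w) + (sj * sk * qj * qk - R0 j k)))).
  apply/funext => w; rewrite product_errorE !epsilonE -/sj -/sk -/qj -/qk.
  by case: (Y01 i j w) => ->; case: (Y01 i k w) => ->; ring.
have bYY a b := bounded_rv_response2 i a b.
have bZ c a b := bounded_rvZ c (bYY a b).
have bC (c : R) : bounded_rv (fun _ : T => c) by exact: bounded_rv_cst.
have uZ c a b := uncorrelatedZ c (bYY a b) bg (Yg a b).
have uC c := uncorrelated_cst P c bg.
have bkC := bounded_rvD (bZ (- (sj * sk * qj)) k k)
  (bC (sj * sk * qj * qk - R0 j k)).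
apply: uncorrelatedD => //; first exact: bounded_rvD.
apply: uncorrelatedD => //.
exact: uncorrelatedD.
Qed.

Variable Rbar : 'M[R]_m.

Lemma noise_sandwichE w : Mhat X (y w) Rbar beta0 - Mbar X Rbar R0 beta0 =
  \sum_i ((X i)^T *m A_half (X i) beta0 *m invmx Rbar) *m product_error w i *m
    (invmx Rbar *m A_half (X i) beta0 *m X i).
Proof.
rewrite -sumrB; apply: eq_bigr => i _.
by rewrite /product_error mulmxBr mulmxBl !mulmxA.
Qed.
Let D w i := ((X i)^T *m A_half (X i) beta0 *m invmx Rbar) *m
    product_error w i *m (invmx Rbar *m A_half (X i) beta0 *m X i).

Lemma bounded_rv_noise i a b : bounded_rv (fun w => D w i a b).
Proof.
apply: bounded_rv_mulmxr; apply: bounded_rv_mulmxl.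
exact: bounded_rv_product_error.
Qed.

Lemma mean_noise i a b : mean P (fun w => D w i a b) = 0.
Proof.
apply: mean_mulmxr.
  by apply: bounded_rv_mulmxl; exact: bounded_rv_product_error.
apply: mean_mulmxl; [exact: bounded_rv_product_error|exact: mean_product_error].
Qed.

Lemma uncorrelated_noise i (g : T -> R) : bounded_rv g ->
  (forall j k, uncorrelated P (fun w => Y i j w * Y i k w) g) ->
  forall a b, uncorrelated P (fun w => D w i a b) g.
Proof.
move=> bg Yg; apply: uncorrelated_mulmxr => //.
  by apply: bounded_rv_mulmxl; exact: bounded_rv_product_error.
apply: uncorrelated_mulmxl => //; first exact: bounded_rv_product_error.
exact: uncorrelated_product_error.
Qed.

(** Replace the products of responses by noise in one factor, then in the other. *)
Lemma noise_uncorrelated i i' a b : i != i' ->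
  uncorrelated P (fun w => D w i a b) (fun w => D w i' a b).
Proof.
move=> ii'; apply: uncorrelated_noise => [|j k]; first exact: bounded_rv_noise.
apply: uncorrelated_sym; apply: uncorrelated_noise => [|j' k'].
  exact: bounded_rv_response2.
by apply: response_products_uncorrelated; rewrite eq_sym.
Qed.

Variables (b1 b2 : R) (hb1 : 0 < b1) (hb2 : b2 < 1).
Hypothesis pib : forall i j, b1 <= pi_ (X i) beta0 j 0 <= b2.
Variable q : R.
Hypothesis Xq : forall i j, frobenius_norm (row j (X i)) <= q.
Hypothesis q0 : 0 <= q.

(** The product of the bounds on the factors of a summand of the noise, apart
    from the two covariate matrices, whose rows contribute q^2. *)
Definition noise_constant : R :=
  (m%:R * ((m * m)%:R * 1) * frobenius_norm (invmx Rbar)) ^+ 2 *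
  ((m * m)%:R * (2 * (1 + b1^-1 + (1 - b2)^-1) ^+ 2)).

Lemma frobenius_norm_rows i : frobenius_norm (X i) <= m%:R * q.
Proof.
apply: frobenius_norm_le; first by rewrite mulr_ge0.
apply: (@le_trans _ _ (m%:R * q ^+ 2)).
  rewrite sqr_frobenius_norm; apply: (@le_trans _ _ (\sum_(j < m) q ^+ 2)).
    apply: ler_sum => j _; have : frobenius_norm (row j (X i)) ^+ 2 <= q ^+ 2.
      by rewrite ler_sqr ?nnegrE ?frobenius_norm_ge0.
    rewrite sqr_frobenius_norm big_ord1.
    by under eq_bigr do rewrite mxE.
  by rewrite sumr_const card_ord mulr_natl.
rewrite exprMn ler_wpM2r ?sqr_ge0 // -natrX ler_nat.
by case: (m) => // c; rewrite leq_pmulr.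
Qed.

Lemma noise_bound w i : frobenius_norm (D w i) <= noise_constant * q ^+ 2.
Proof.
have V0 : 0 <= 1 + b1^-1 + (1 - b2)^-1.
  by rewrite !addr_ge0 // invr_ge0 ltW // subr_gt0.
have Ah : frobenius_norm (A_half (X i) beta0) <= (m * m)%:R * 1.
  apply: frobenius_norm_le_entry => // j k; rewrite !mxE.
  by case: eqP => _; rewrite ?mulr1n ?mulr0n ?normr0 // sqrt_A_le1.
have eV u j : `|eps u i j 0| <= 1 + b1^-1 + (1 - b2)^-1.
  have [h1 h2] := root_odds_le hb1 hb2 (pib i j).
  have h0 : `|(X i *m (beta0 - beta0)) j 0| <= (0 : R).
    by rewrite subrr mulmx0 mxE normr0.
  have [] // := epsilon_perturb h1 h2 ler01 h0 (yi := y u i).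
  by rewrite mxE; exact: Y01.
have eeV j k u : `|eps u i j 0 * eps u i k 0| <= (1 + b1^-1 + (1 - b2)^-1) ^+ 2.
  by rewrite normrM expr2 ler_pM.
have zV : frobenius_norm (product_error w i) <=
    (m * m)%:R * (2 * (1 + b1^-1 + (1 - b2)^-1) ^+ 2).
  apply: frobenius_norm_le_entry => [|j k]; first by rewrite mulr_ge0 ?sqr_ge0.
  rewrite product_errorE; apply: le_trans (ler_normB _ _) _.
  rewrite mulr_natl mulr2n lerD // -(mean_epsilon_product i).
  apply: mean_norm_le => //; apply: bounded_rvM; exact: bounded_rv_epsilon.
set W := frobenius_norm (invmx Rbar).
have W0 : 0 <= W by exact: frobenius_norm_ge0.
set a := (m * m)%:R * 1 in Ah *.
have a0 : 0 <= a by rewrite mulr_ge0.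
set z := (m * m)%:R * _ in zV *.
have L : frobenius_norm ((X i)^T *m A_half (X i) beta0 *m invmx Rbar) <=
    m%:R * q * a * W.
  apply: le_trans (frobenius_normM _ _) _.
  rewrite ler_pM ?frobenius_norm_ge0 //.
  apply: le_trans (frobenius_normM _ _) _.
  rewrite ler_pM ?frobenius_norm_ge0 //.
  by rewrite frobenius_norm_tr frobenius_norm_rows.
have L' : frobenius_norm (invmx Rbar *m A_half (X i) beta0 *m X i) <=
    W * a * (m%:R * q).
  apply: le_trans (frobenius_normM _ _) _.
  rewrite ler_pM ?frobenius_norm_ge0 //.
    apply: le_trans (frobenius_normM _ _) _.
    rewrite ler_pM ?frobenius_norm_ge0 //.
  exact: frobenius_norm_rows.
have -> : noise_constant * q ^+ 2 = m%:R * q * a * W * z * (W * a * (m%:R * q)).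
  by rewrite /noise_constant -/W -/a -/z; ring.
apply: le_trans (frobenius_normM _ _) _; rewrite ler_pM ?frobenius_norm_ge0 //.
by apply: le_trans (frobenius_normM _ _) _; rewrite ler_pM ?frobenius_norm_ge0.
Qed.

(** Entrywise, the noise is a sum of centred uncorrelated variables, so its mean
    square is n^-2 times the sum of those of the n summands, each of order q^4. *)
Lemma mean_sqr_noise_le : (0 < n)%N ->
  mean P (fun w => frobenius_norm
    (n%:R^-1 *: (Mhat X (y w) Rbar beta0 - Mbar X Rbar R0 beta0)) ^+ 2) <=
  n%:R^-1 * (noise_constant * q ^+ 2) ^+ 2.
Proof.
move=> n0; have nR : 0 < n%:R :> R by rewrite ltr0n.
have bD i (a b : 'I_p) : bounded_rv (fun w => D w i a b) by exact: bounded_rv_noise.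
have bD2 i (a b : 'I_p) : bounded_rv (fun w => D w i a b ^+ 2).
  by under eq_fun do rewrite expr2; exact: bounded_rvM.
have bS (a b : 'I_p) : bounded_rv (fun w => (\sum_i D w i a b) ^+ 2).
  by under eq_fun do rewrite expr2; apply: bounded_rvM; exact: bounded_rv_sum.
have -> : (fun w => frobenius_norm
      (n%:R^-1 *: (Mhat X (y w) Rbar beta0 - Mbar X Rbar R0 beta0)) ^+ 2) =
    (fun w => n%:R^-1 ^+ 2 * \sum_a \sum_b (\sum_i D w i a b) ^+ 2).
  apply/funext => w; rewrite frobenius_normZ exprMn real_normK ?num_real //.
  rewrite noise_sandwichE sqr_frobenius_norm; congr (_ * _).
  by do 2!(apply: eq_bigr => ? _); rewrite summxE.
rewrite meanZ; last by do 2!(apply: bounded_rv_sum => ?).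
have -> : mean P (fun w => \sum_a \sum_b (\sum_i D w i a b) ^+ 2) =
    \sum_i mean P (fun w => frobenius_norm (D w i) ^+ 2).
  rewrite mean_sum => [|a]; last exact: bounded_rv_sum.
  have -> : \sum_a mean P (fun w => \sum_b (\sum_i D w i a b) ^+ 2) =
      \sum_(a < p) \sum_(b < p) \sum_i mean P (fun w => D w i a b ^+ 2).
    apply: eq_bigr => a _; rewrite mean_sum //; apply: eq_bigr => b _.
    rewrite mean_sqr_sum_uncorrelated // => [i|i j ij]; first exact: mean_noise.
    exact: noise_uncorrelated.
  under eq_bigr do rewrite exchange_big /=; rewrite exchange_big /=.
  apply: eq_bigr => i _; under [in RHS]eq_fun do rewrite sqr_frobenius_norm.
  rewrite mean_sum => [|a]; last exact: bounded_rv_sum.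
  by apply: eq_bigr => a _; rewrite mean_sum.
apply: (@le_trans _ _ (n%:R^-1 ^+ 2 *
    \sum_(i < n) (noise_constant * q ^+ 2) ^+ 2)).
  rewrite ler_wpM2l ?sqr_ge0 //; apply: ler_sum => i _.
  have bN : bounded_rv (fun w => frobenius_norm (D w i) ^+ 2).
    under eq_fun do rewrite sqr_frobenius_norm.
    by do 2!(apply: bounded_rv_sum => ?).
  apply: le_trans (ler_norm _) _; apply: mean_norm_le => // w.
  rewrite ger0_norm ?sqr_ge0 //.
  have Dw := noise_bound w i.
  rewrite ler_sqr ?nnegrE ?frobenius_norm_ge0 //.
  by rewrite (le_trans _ Dw) ?frobenius_norm_ge0.
rewrite sumr_const card_ord -[_ *+ n]mulr_natl le_eqVlt; apply/orP; left.
by apply/eqP; field; rewrite gt_eqF.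
Qed.

Lemma noise_tail (eta : R) : (0 < n)%N -> 0 < eta ->
  (P [set w | (eta ^+ 2 < frobenius_norm
     (n%:R^-1 *: (Mhat X (y w) Rbar beta0 - Mbar X Rbar R0 beta0)) ^+ 2)%R] <=
   (eta ^- 2 * (n%:R^-1 * (noise_constant * q ^+ 2) ^+ 2))%:E)%E.
Proof.
move=> n0 eta0; have eta20 := exprn_gt0 2 eta0.
pose f w := frobenius_norm
  (n%:R^-1 *: (Mhat X (y w) Rbar beta0 - Mbar X Rbar R0 beta0)) ^+ 2.
have bf : bounded_rv f.
  rewrite /f; under eq_fun do (rewrite noise_sandwichE sqr_frobenius_norm).
  do 2!(apply: bounded_rv_sum => ?); under eq_fun do rewrite expr2 mxE summxE.
  by apply: bounded_rvM; apply: bounded_rvZ; apply: bounded_rv_sum => i;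
    exact: bounded_rv_noise.
apply: le_trans (markov_bounded P bf (fun w => sqr_ge0 _) eta20) _.
by rewrite lee_fin ler_wpM2l ?invr_ge0 ?(ltW eta20) // mean_sqr_noise_le.
Qed.

End ClusterNoise.

(** * Measurability of the estimators *)

Section MatrixMeasurability.
Variables (R : realType) (d : measure_display) (T : measurableType d).

(** Inversion is not continuous at 0; with 0^-1 = 0 it is x (x^2)^-1, and the
    power (x^2)^-1 is a measurable real power. *)
Lemma measurable_fun_inv (f : T -> R) : measurable_fun [set: T] f ->
  measurable_fun [set: T] (fun w => (f w)^-1).
Proof.
move=> mf.
have -> : (fun w => (f w)^-1) = (fun w => f w * (f w ^+ 2) `^ (-1)).
  apply/funext => w; rewrite powR_inv1 ?sqr_ge0 //.
  have [->|f0] := eqVneq (f w) 0; first by rewrite invr0 mul0r.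
  by field.
apply: measurable_funM => //.
apply: (measurableT_comp (measurable_powR (-1))).
by under eq_fun do rewrite expr2; exact: measurable_funM.
Qed.

Lemma measurable_fun_sqrt (f : T -> R) : measurable_fun [set: T] f ->
  measurable_fun [set: T] (fun w => Num.sqrt (f w)).
Proof.
apply: measurableT_comp; apply: continuous_measurable_fun.
exact: sqrt_continuous.
Qed.

Definition measurable_mx a b (F : T -> 'M[R]_(a, b)) : Prop :=
  forall i j, measurable_fun [set: T] (fun w => F w i j).

Lemma measurable_mx_cst a b (A : 'M[R]_(a, b)) : measurable_mx (fun _ => A).
Proof. by move=> i j; exact: measurable_cst. Qed.

Lemma measurable_mxM a b c (F : T -> 'M[R]_(a, b)) (G : T -> 'M[R]_(b, c)) :
  measurable_mx F -> measurable_mx G -> measurable_mx (fun w => F w *m G w).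
Proof.
move=> mF mG i j; under eq_fun do rewrite mxE.
by apply: measurable_sum => k; exact: measurable_funM.
Qed.

Lemma measurable_mxB a b (F G : T -> 'M[R]_(a, b)) :
  measurable_mx F -> measurable_mx G -> measurable_mx (fun w => F w - G w).
Proof.
move=> mF mG i j.
have -> : (fun w => (F w - G w) i j) = (fun w => F w i j - G w i j).
  by apply/funext => w; rewrite !mxE.
exact: measurable_funB.
Qed.

Lemma measurable_mxZ a b c (F : T -> 'M[R]_(a, b)) :
  measurable_mx F -> measurable_mx (fun w => c *: F w).
Proof.
by move=> mF i j; under eq_fun do rewrite mxE; exact: measurable_funM.
Qed.

Lemma measurable_mx_tr a b (F : T -> 'M[R]_(a, b)) :
  measurable_mx F -> measurable_mx (fun w => (F w)^T).
Proof. by move=> mF i j; under eq_fun do rewrite mxE; exact: mF. Qed.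

Lemma measurable_mx_sum a b (I : finType) (F : I -> T -> 'M[R]_(a, b)) :
  (forall i, measurable_mx (F i)) -> measurable_mx (fun w => \sum_i F i w).
Proof.
move=> mF i j; under eq_fun do rewrite summxE.
by apply: measurable_sum => k; exact: mF.
Qed.

Lemma measurable_mx_diag a (f : 'I_a -> T -> R) :
  (forall i, measurable_fun [set: T] (f i)) ->
  measurable_mx (fun w => diag_mx (\row_i f i w)).
Proof.
move=> mf i j; under eq_fun do rewrite !mxE.
by case: eqP => _; [exact: mf|exact: measurable_cst].
Qed.

Lemma measurable_det a (F : T -> 'M[R]_a) :
  measurable_mx F -> measurable_fun [set: T] (fun w => \det (F w)).
Proof.
move=> mF; apply: measurable_sum => s; apply: measurable_funM => //.
by apply: measurable_prod => i _; exact: mF.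
Qed.

(** The inverse is det^-1 times the adjugate; where det vanishes, so does
    det^-1, and [invmx] returns the matrix itself, which the second summand
    restores. *)
Lemma measurable_mx_inv a (F : T -> 'M[R]_a) :
  measurable_mx F -> measurable_mx (fun w => invmx (F w)).
Proof.
move=> mF i j; pose dt w := \det (F w).
have -> : (fun w => invmx (F w) i j) = (fun w =>
    (dt w)^-1 * cofactor (F w) j i + (1 - dt w * (dt w)^-1) * F w i j).
  apply/funext => w; rewrite /invmx unitmxE unitfE -/(dt w).
  have [->|dt0] := eqVneq (dt w) 0.
    by rewrite /= invr0 !mul0r add0r subr0 mul1r.
  by rewrite /= mulfV // subrr mul0r addr0 !mxE.
have mdt : measurable_fun [set: T] dt by exact: measurable_det.
have mdti := measurable_fun_inv mdt.
have mcof : measurable_fun [set: T] (fun w => cofactor (F w) j i).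
  apply: measurable_funM => //; apply: measurable_det => k l.
  by under eq_fun do rewrite !mxE; exact: mF.
apply: measurable_funD; first exact: measurable_funM.
apply: measurable_funM => //; apply: measurable_funB => //.
exact: measurable_funM.
Qed.

Lemma measurable_frobenius_norm a b (F : T -> 'M[R]_(a, b)) :
  measurable_mx F -> measurable_fun [set: T] (fun w => frobenius_norm (F w)).
Proof.
move=> mF; apply: measurable_fun_sqrt; do 2!apply: measurable_sum => ?.
by under eq_fun do rewrite expr2; exact: measurable_funM.
Qed.

Section Gee.
Variables (n m p : nat) (X : 'I_n -> 'M[R]_(m, p)).
Variables (y : 'I_n -> T -> 'cV[R]_m) (W : T -> 'M[R]_m) (beta : T -> 'cV[R]_p).
Hypotheses (my : forall i, measurable_mx (y i)) (mW : measurable_mx W).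
Hypothesis mbeta : measurable_mx beta.

Lemma measurable_pi i : measurable_mx (fun w => pi_ (X i) (beta w)).
Proof.
move=> j k; have mt : measurable_fun [set: T]
    (fun w => expR ((X i *m beta w) j 0)).
  apply: (measurableT_comp (@measurable_expR R)).
  by apply: measurable_mxM => //; exact: measurable_mx_cst.
under eq_fun do rewrite /pi_ mxE.
apply: measurable_funM => //; apply: measurable_fun_inv.
exact: measurable_funD.
Qed.

Lemma measurable_sqrt_A i j :
  measurable_fun [set: T] (fun w => Num.sqrt (A_ (X i) (beta w) j)).
Proof.
apply: measurable_fun_sqrt; apply: measurable_funM; first exact: measurable_pi.
by apply: measurable_funB => //; exact: measurable_pi.
Qed.

Lemma measurable_A_half i : measurable_mx (fun w => A_half (X i) (beta w)).
Proof. by apply: measurable_mx_diag => j; exact: measurable_sqrt_A. Qed.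

Lemma measurable_epsilon i :
  measurable_mx (fun w => epsilon_ (X i) (y i w) (beta w)).
Proof.
apply: measurable_mxM.
  apply: measurable_mx_diag => j; apply: measurable_fun_inv.
  exact: measurable_sqrt_A.
by apply: measurable_mxB => //; exact: measurable_pi.
Qed.

Lemma measurable_H : measurable_mx (fun w => H_ X (W w) (beta w)).
Proof.
apply: measurable_mx_sum => i; do !apply: measurable_mxM;
  by [exact: measurable_mx_cst|exact: measurable_A_half|exact: measurable_mx_inv].
Qed.

Lemma measurable_Mhat :
  measurable_mx (fun w => Mhat X (fun i => y i w) (W w) (beta w)).
Proof.
apply: measurable_mx_sum => i.
have mA := measurable_A_half i; have me := measurable_epsilon i.
have metr := measurable_mx_tr me; have mWi := measurable_mx_inv mW.
by do 7!(apply: (measurable_mxM _ _) => //); exact: measurable_mx_cst.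
Qed.

Lemma measurable_Sigmahat :
  measurable_mx (fun w => Sigmahat X (fun i => y i w) (W w) (beta w)).
Proof.
have mH := measurable_mx_inv measurable_H.
by do 2!apply: measurable_mxM => //; exact: measurable_Mhat.
Qed.

End Gee.
End MatrixMeasurability.

(** * Stochastic orders and rates *)

Section Tails.
Variable R : realType.

Lemma ereal_cvg0 (u : nat -> \bar R) : (forall n, (0 <= u n)%E) ->
  (forall e : R, 0 < e -> \forall n \near \oo, (u n <= e%:E)%E) ->
  u @ \oo --> 0%E.
Proof.
move=> u0 ue; apply/fine_cvgP; split.
  apply: filterS (ue 1 ltr01) => n un.
  by rewrite ge0_fin_numE // (le_lt_trans un) // ltry.
apply/cvgr0Pnorm_le => e e0; apply: filterS (ue e e0) => n un /=.
have fu : u n \is a fin_num by rewrite ge0_fin_numE // (le_lt_trans un) // ltry.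
by rewrite ger0_norm ?fine_ge0 // -lee_fin fineK.
Qed.

Variables (d : nat -> measure_display) (T : forall n, measurableType (d n)).
Variable P : forall n, probability (T n) R.

(** If s r vanishes, then for large n the event that s |Z| exceeds eta is
    contained in the event that |Z| exceeds M r. *)
Lemma bigO_p_scaled_tail (Z : forall n, T n -> R) (r s : nat -> R) (eta : R) :
  (forall n, measurable_fun [set: T n] (Z n)) -> (forall n, 0 <= s n) ->
  (forall e, 0 < e -> \forall n \near \oo, s n * r n <= e) ->
  bigO_p P Z r -> 0 < eta -> forall e : R, 0 < e ->
  \forall n \near \oo, (P n [set w | (eta < s n * `|Z n w|)%R] <= e%:E)%E.
Proof.
move=> mZ s0 sr OZ eta0 e e0; have [M M0 PM] := OZ e e0.
have sM : \forall n \near \oo, s n * r n <= eta / M by apply: sr; rewrite divr_gt0.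
apply: filterS2 PM sM => n PM sM; apply: le_trans PM.
have mZn : measurable_fun [set: T n] (fun w => `|Z n w|).
  by apply: measurableT_comp => //; exact: normr_measurable.
apply: le_measure; rewrite ?inE.
- by apply: measurable_gt; exact: measurable_funM.
- exact: measurable_gt.
move=> w /=; rewrite !ltNge; apply: contra => Zw.
apply: le_trans (ler_wpM2l (s0 n) Zw) _.
by rewrite mulrCA mulrC -ler_pdivlMr.
Qed.

End Tails.

Section RateFacts.
Variables (R : realType) (p : nat -> nat).
Hypothesis rate : (fun n => n%:R^-1 * (p n)%:R ^+ 3 : R) @ \oo --> (0 : R).

Lemma rate_sqr (e : R) : 0 < e ->
  \forall n \near \oo, n%:R^-1 * (p n)%:R ^+ 2 <= e.
Proof.
move=> e0; have /cvgr0Pnorm_le/(_ e e0) := rate; apply: filterS => n.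
rewrite ger0_norm ?mulr_ge0 ?invr_ge0 ?exprn_ge0 //; apply: le_trans.
rewrite ler_wpM2l ?invr_ge0 // -!natrX ler_nat.
by case: (p n) => // k; rewrite leq_pexp2l.
Qed.

Lemma rate_sqrt (e : R) : 0 < e ->
  \forall n \near \oo, Num.sqrt ((p n)%:R / n%:R) <= e.
Proof.
move=> e0; have := rate_sqr (exprn_gt0 2 e0); apply: filterS => n h.
rewrite -ler_sqr ?nnegrE ?sqrtr_ge0 ?(ltW e0) // sqr_sqrtr; last first.
  by rewrite divr_ge0.
apply: le_trans h; rewrite mulrC ler_wpM2l ?invr_ge0 // -natrX ler_nat.
by case: (p n) => // k; rewrite leq_pmulr.
Qed.

Lemma rate_sqrt_sqrt (K e : R) : 0 < K -> 0 < e ->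
  \forall n \near \oo, K * Num.sqrt (p n)%:R * Num.sqrt ((p n)%:R / n%:R) <= e.
Proof.
move=> K0 e0; have eK : 0 < e / K by rewrite divr_gt0.
have := rate_sqr (exprn_gt0 2 eK); apply: filterS => n h.
rewrite -mulrA -ler_pdivlMl // [K^-1 * e]mulrC.
rewrite -ler_sqr ?nnegrE ?(ltW eK) ?mulr_ge0 ?sqrtr_ge0 //.
rewrite exprMn !sqr_sqrtr ?divr_ge0 //.
by apply: le_trans h; rewrite mulrA mulrC expr2.
Qed.

End RateFacts.

(** * Consistency of the sandwich covariance estimator *)

Theorem theorem3p10 (R : realType) (m : nat) (hm : (0 < m)%N)
  (p : nat -> nat) (hp : p @ \oo --> \oo)
  (d : nat -> measure_display) (T : forall n, measurableType (d n))
  (P : forall n, probability (T n) R)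
  (* fixed covariates, binary responses *)
  (X : forall n, 'I_n -> 'M[R]_(m, p n))
  (Y : forall n, 'I_n -> 'I_m -> {RV (P n) >-> R})
  (Y01 : forall n (i : 'I_n) (j : 'I_m) (w : T n),
     Y n i j w = 0 \/ Y n i j w = 1)
  (Yindep : forall n, mutually_independent (P n)
     (fun (i : 'I_n) (w : T n) => [tuple Y n i j w | j < m]))
  (* true parameter and true correlation *)
  (beta0 : forall n, 'cV[R]_(p n))
  (EY : forall n (i : 'I_n) (j : 'I_m),
     ('E_(P n)[Y n i j] = (pi_ (X n i) (beta0 n) j 0)%:E)%E)
  (R0 : nat -> 'M[R]_m)
  (corY : forall n (i : 'I_n) (j k : 'I_m),
     R0 n j k = correlation (P n) (Y n i j) (Y n i k))
  (* estimated working correlation matrix and its limit *)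
  (Rhat : forall n, T n -> 'M[R]_m)
  (Rhat_meas : forall n (j k : 'I_m),
     measurable_fun [set: T n] (fun w => Rhat n w j k))
  (Rhat_corr : forall n (w : T n), correlation_matrix (Rhat n w))
  (Rhat_inv : (fun n => P n [set w | Rhat n w \in unitmx]) @ \oo --> 1%E)
  (Rbar : 'M[R]_m)
  (* (A1) *)
  (A1 : (fun n => \big[Num.max/0]_(i < n) \big[Num.max/0]_(j < m)
            frobenius_norm (row j (X n i)))
        =O_\oo (fun n => Num.sqrt (p n)%:R : R))
  (* (A2) *)
  (B : forall n, set 'cV[R]_(p n))
  (A2_compact : forall n, compact (B n))
  (A2_interior : forall n, (B n)° (beta0 n))
  (b1 b2 : R) (hb1 : 0 < b1) (hb2 : b2 < 1)
  (A2_pi : \forall n \near \oo, forall (i : 'I_n) (j : 'I_m),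
     b1 <= pi_ (X n i) (beta0 n) j 0 <= b2)
  (* (A3) *)
  (b3 b4 : R) (hb3 : 0 < b3) (hb4 : 0 < b4)
  (A3 : \forall n \near \oo,
     let XX := n%:R^-1 *: \sum_(i < n) (X n i)^T *m X n i in
     b3 <= lambda_min XX /\ lambda_max XX <= b4)
  (* (A4) *)
  (c1 c2 : R) (hc1 : 0 < c1)
  (A4_R0 : \forall n \near \oo,
     c1 <= lambda_min (R0 n) /\ lambda_max (R0 n) <= c2)
  (c3 c4 : R) (hc3 : 0 < c3)
  (A4_Rbar : [/\ positive_definite Rbar, c3 <= lambda_min Rbar &
                lambda_max Rbar <= c4])
  (A4_Rhat : bigO_p P
     (fun n w => frobenius_norm (invmx (Rhat n w) - invmx Rbar))
     (fun n => Num.sqrt ((p n)%:R / n%:R)))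
  (* p_n^3 / n = o(1) *)
  (rate : (fun n => n%:R^-1 * (p n)%:R ^+ 3 : R) @ \oo --> (0 : R))
  (* the GEE estimator *)
  (betahat : forall n, T n -> 'cV[R]_(p n))
  (betahat_meas : forall n (k : 'I_(p n)),
     measurable_fun [set: T n] (fun w => betahat n w k 0))
  (betahat_root : (fun n => P n [set w |
       gee_score (X n) (fun i => \col_j Y n i j w) (Rhat n w) (betahat n w)
       = 0]) @ \oo --> 1%E)
  (betahat_rate : bigO_p P
     (fun n w => frobenius_norm (betahat n w - beta0 n))
     (fun n => Num.sqrt ((p n)%:R / n%:R)))
  (* the fixed number of linear combinations *)
  (l : nat) (G : 'M[R]_l) (hG : positive_definite G)
  (C : forall n, 'M[R]_(l, p n))
  (hC : \forall n \near \oo, C n *m (C n)^T = G) :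
  littleo_p P
    (fun n w => frobenius_norm
       (C n *m Sigmahat (X n) (fun i => \col_j Y n i j w) (Rhat n w)
                 (betahat n w) *m (C n)^T
        - C n *m Sigma (X n) Rbar (R0 n) (beta0 n) *m (C n)^T))
    (fun n => n%:R^-1).
Proof.
have b20 : 0 < 1 - b2 by rewrite subr_gt0.
have [Rbar_pos _ _] := A4_Rbar.
have [K K0 perturb] := sandwich_perturbation hb1 hb2 hb3 hb4 Rbar_pos.
have /eqO_exP[q0 q00 A1'] := A1.
pose q n : R := q0 * Num.sqrt (p n)%:R.
have q_ge0 n : 0 <= q n by rewrite mulr_ge0 ?sqrtr_ge0 ?ltW.
pose g := `|\tr G|; have g0 : 0 <= g by exact: normr_ge0.
move=> e e0.
(* The largest del for which the deterministic bound applies and for which its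
   consequence for the compressed matrices is at most e. *)
pose eta := Num.min K^-1 (e / (K * (g + 1))).
have eta0 : 0 < eta.
  by rewrite lt_min invr_gt0 K0 divr_gt0 // mulr_gt0 // ltr_wpDl.
have Keta1 : K * eta <= 1.
  by rewrite -ler_pdivlMl // mulr1 ge_min lexx.
have Ketae : K * eta * g <= e.
  have h : eta <= e / (K * (g + 1)) by rewrite ge_min lexx orbT.
  have := ler_wpM2l (mulr_ge0 (ltW K0) g0) h; rewrite mulrAC => /le_trans; apply.
  have -> : K * g * (e / (K * (g + 1))) = e * (g / (g + 1)).
    by field; rewrite !gt_eqF // ltr_wpDl.
  by rewrite ler_piMr ?(ltW e0) // ler_pdivrMr ?mul1r ?lerDl // ltr_wpDl.
pose y n w : 'I_n -> 'cV[R]_m := fun i => \col_j Y n i j w.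
pose ZR n w := frobenius_norm (invmx (Rhat n w) - invmx Rbar).
pose ZB n w := frobenius_norm (betahat n w - beta0 n).
pose ZD n w := frobenius_norm (n%:R^-1 *: (Mhat (X n) (y n w) Rbar (beta0 n) -
  Mbar (X n) Rbar (R0 n) (beta0 n))).
have my n i : measurable_mx (fun w => y n w i).
  by move=> j k; under eq_fun do rewrite mxE; exact: measurable_funPT.
have mR n : measurable_mx (Rhat n) by move=> j k; exact: Rhat_meas.
have mB n : measurable_mx (betahat n).
  by move=> j k; rewrite (ord1 k); exact: betahat_meas.
have mZR n : measurable_fun [set: T n] (ZR n).
  apply: measurable_frobenius_norm; apply: measurable_mxB.
    exact: measurable_mx_inv.
  exact: measurable_mx_cst.
have mZB n : measurable_fun [set: T n] (ZB n).
  apply: measurable_frobenius_norm.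
  exact: (measurable_mxB (mB n) (@measurable_mx_cst _ _ _ _ _ (beta0 n))).
have mZD n : measurable_fun [set: T n] (ZD n).
  apply: measurable_frobenius_norm; apply: measurable_mxZ.
  apply: measurable_mxB; last exact: measurable_mx_cst.
  apply: (@measurable_Mhat _ _ _ _ _ _ (X n) (fun i w => y n w i) (fun=> Rbar)
    (fun=> beta0 n)) => //; exact: measurable_mx_cst.
have rateR (e' : R) : 0 < e' ->
    \forall n \near \oo, 1 * Num.sqrt ((p n)%:R / n%:R) <= e'.
  by move=> /(rate_sqrt rate); apply: filterS => n; rewrite mul1r.
have tailR := bigO_p_scaled_tail (s := fun=> 1) mZR (fun=> ler01)
  rateR A4_Rhat eta0.
have tailB := bigO_p_scaled_tail mZB q_ge0
  (fun e => rate_sqrt_sqrt rate q00) betahat_rate eta0.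
have rowq : \forall n \near \oo, forall i j,
    frobenius_norm (row j (X n i)) <= q n.
  apply: filterS A1' => n h i j; rewrite /q -[Num.sqrt _]ger0_norm ?sqrtr_ge0 //.
  apply: le_trans h; apply: le_trans (ler_norm _).
  apply: le_trans (le_bigmax 0 (fun i =>
    \big[Num.max/0]_(j < m) frobenius_norm (row j (X n i))) i).
  exact: (le_bigmax 0 (fun j => frobenius_norm (row j (X n i))) j).
have n_gt0 : \forall n \near \oo, (0 < n)%N by exact: nbhs_infty_gt.
have tailD (e' : R) : 0 < e' ->
    \forall n \near \oo, (P n [set w | (eta ^+ 2 < ZD n w ^+ 2)%R] <= e'%:E)%E.
  move=> e'0; pose c := eta ^- 2 * (noise_constant Rbar b1 b2 * q0 ^+ 2) ^+ 2.
  have c0 : 0 <= c by rewrite mulr_ge0 ?invr_ge0 ?sqr_ge0.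
  have c10 : 0 < c + 1 by rewrite ltr_wpDl.
  near=> n.
  have n0 : (0 < n)%N by near: n.
  have pibn i j : b1 <= pi_ (X n i) (beta0 n) j 0 <= b2.
    by move: i j; near: n.
  have rown i j : frobenius_norm (row j (X n i)) <= q n.
    by move: i j; near: n; exact: rowq.
  apply: le_trans (noise_tail (Y01 n) (Yindep n) (EY n) (corY n) Rbar hb1 hb2
    pibn rown (q_ge0 n) n0 eta0) _.
  have rn : n%:R^-1 * (p n)%:R ^+ 2 <= e' / (c + 1).
    by near: n; apply: rate_sqr => //; rewrite divr_gt0.
  rewrite lee_fin.
  have -> : eta ^- 2 * (n%:R^-1 * (noise_constant Rbar b1 b2 * q n ^+ 2) ^+ 2) =
      c * (n%:R^-1 * (p n)%:R ^+ 2).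
    rewrite /q (exprMn 2 q0) sqr_sqrtr // /c; ring.
  apply: le_trans (ler_wpM2l c0 rn) _.
  by rewrite mulrCA ler_piMr ?(ltW e'0) // ler_pdivrMr // mul1r lerDl.
refine (ereal_cvg0 _ _) => [n|e' e'0]; first exact: measure_ge0.
have e'3 : 0 < e' / 3 by rewrite divr_gt0.
near=> n.
have n0 : (0 < n)%N by near: n.
have nR : 0 < n%:R :> R by rewrite ltr0n.
have pibn i j : b1 <= pi_ (X n i) (beta0 n) j 0 <= b2.
  by move: i j; near: n.
have rown i j : frobenius_norm (row j (X n i)) <= q n.
  by move: i j; near: n; exact: rowq.
have XX : forall x : 'cV[R]_(p n), b3 * frobenius_norm x ^+ 2 <=
    n%:R^-1 * \sum_i frobenius_norm (X n i *m x) ^+ 2 <=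
    b4 * frobenius_norm x ^+ 2.
  have [h3 h4] : let XX := n%:R^-1 *: \sum_(i < n) (X n i)^T *m X n i in
    b3 <= lambda_min XX /\ lambda_max XX <= b4 by near: n.
  exact: scaled_gram_bounds.
have CG : C n *m (C n)^T = G by near: n.
have PA : (P n [set w | (eta < 1 * `|ZR n w|)%R] <= (e' / 3)%:E)%E.
  by near: n; exact: tailR.
have PB : (P n [set w | (eta < q n * `|ZB n w|)%R] <= (e' / 3)%:E)%E.
  by near: n; exact: tailB.
have PD : (P n [set w | (eta ^+ 2 < ZD n w ^+ 2)%R] <= (e' / 3)%:E)%E.
  by near: n; exact: tailD.
set A := [set w | eta < 1 * `|ZR n w|] in PA *.
set B' := [set w | eta < q n * `|ZB n w|] in PB *.
set D := [set w | eta ^+ 2 < ZD n w ^+ 2] in PD *.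
have mA : measurable A.
  apply: measurable_gt; apply: measurable_funM => //.
  by apply: measurableT_comp => //; exact: normr_measurable.
have mB' : measurable B'.
  apply: measurable_gt; apply: measurable_funM => //.
  by apply: measurableT_comp => //; exact: normr_measurable.
have mD : measurable D.
  by apply: measurable_gt; under eq_fun do rewrite expr2; exact: measurable_funM.
(* Outside the three tail events the deterministic bound gives the claim. *)
apply: (@le_trans _ _ (P n (A `|` (B' `|` D)))); last first.
  apply: le_trans (measureU2 _ mA (measurableU _ _ mB' mD)) _.
  have -> : e'%:E = ((e' / 3)%:E + ((e' / 3)%:E + (e' / 3)%:E))%E.
    by rewrite -!EFinD; congr EFin; field.
  apply: leeD => //; apply: le_trans (measureU2 _ mB' mD) _.
  exact: leeD.
have mS := measurable_Sigmahat (X n) (my n) (mR n) (mB n).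
apply: le_measure; rewrite ?inE.
- apply: measurable_gt; apply: measurableT_comp; first exact: normr_measurable.
  apply: measurable_frobenius_norm; apply: measurable_mxB.
    by do 2!apply: measurable_mxM => //; exact: measurable_mx_cst.
  exact: measurable_mx_cst.
- by apply: measurableU => //; exact: measurableU.
move=> w /=; apply: contraPP => /not_orP[wA /not_orP[wB wD]].
apply/negP; rewrite -leNgt ger0_norm ?frobenius_norm_ge0 //.
have Cg : frobenius_norm (C n) ^+ 2 <= g.
  apply: le_trans (ler_norm _); rewrite -CG sqr_frobenius_norm /mxtrace.
  apply: ler_sum => i _; rewrite mxE; apply: ler_sum => j _.
  by rewrite mxE expr2.
have y01 i j : y n w i j 0 = 0 \/ y n w i j 0 = 1.
  by rewrite mxE; exact: Y01.
have Rdel : frobenius_norm (invmx (Rhat n w) - invmx Rbar) <= eta.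
  move: wA => /negP; rewrite -leNgt mul1r; exact: le_trans (ler_norm _).
have bdel i j : `|(X n i *m (betahat n w - beta0 n)) j 0| <= eta.
  have -> : (X n i *m (betahat n w - beta0 n)) j 0 =
      (row j (X n i) *m (betahat n w - beta0 n)) 0 0.
    by rewrite -row_mul [RHS]mxE.
  apply: le_trans (entry_le _ _ _) _; apply: le_trans (frobenius_normM _ _) _.
  move: wB => /negP; rewrite -leNgt; apply: le_trans.
  rewrite ger0_norm ?frobenius_norm_ge0 //.
  by rewrite ler_wpM2r ?frobenius_norm_ge0.
have Ddel : ZD n w <= eta.
  move: wD => /negP; rewrite -leNgt ler_sqr ?nnegrE ?frobenius_norm_ge0 //.
  exact: ltW.
have bS := perturb n (p n) (X n) (y n w) (Rhat n w) (R0 n) (beta0 n)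
  (betahat n w) eta n0 y01 pibn XX (ltW eta0) Keta1 Rdel bdel Ddel.
have Keta0 : 0 <= K * eta by rewrite mulr_ge0 // ltW.
apply: le_trans (frobenius_norm_congruenceB (C n) nR Keta0 bS) _.
rewrite [leRHS]mulrC ler_wpM2l ?invr_ge0 //; apply: le_trans Ketae.
by rewrite ler_wpM2l.
Unshelve. all: by end_near.
Qed.
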